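(* Fix integers $k\geq3$ and $d\geq1$. Let $\mathbf{e}$ be the standard basis of $\mathbb{R}^d$. The following are equivalent: (i) every $A\subseteq\mathbb{N}^d$ satisfying $\limsup_{N\to\infty}\frac{|A\cap[1,N]^d|}{N^d}>0$ contains a $(k,0,\mathbf{e})$-AP; (ii) $r_{k,d}(N)/N^d\to0$ as $N\to\infty$; (iii) $\epsilon^{d-D_{\mathrm{S}}(k,\epsilon,d,d)}\to0$ as $\epsilon\to+0$; (iv) $\epsilon^{d-D_{\mathrm{H}}(k,\epsilon,d,d)}\to0$ as $\epsilon\to+0$; (v) $\epsilon^{d-D_{\mathrm{A}}(k,\epsilon,d,d)}\to0$ as $\epsilon\to+0$.
   Context: $\mathbb{N}$ is the set of positive integers. Let $\mathbf{v}=\{v_1,\ldots,v_d\}$ be a set of $d$ pairwise orthogonal unit vectors in $\mathbb{R}^d$. For a positive integer $k$ and $\Delta>0$, a set $P\subset\mathbb{R}^d$ is an arithmetic patch of size $k$ and scale $\Delta$ with orientation $\mathbf{v}$ if $P=\{t+\Delta\sum_{i=1}^d x_iv_i : x_i=0,1,\ldots,k-1\}$ for some $t\in\mathbb{R}^d$. For $\epsilon\in[0,1/2)$, a set $Q\subset\mathbb{R}^d$ is a $(k,\epsilon,\mathbf{v})$-AP if there is an arithmetic patch $P$ of size $k$ and some scale $\Delta>0$ with orientation $\mathbf{v}$ such that $\sup_{x\in P}\inf_{y\in Q}\|x-y\|\leq\epsilon\Delta$ (Euclidean norm). In particular a $(k,0,\mathbf{e})$-AP in $\mathbb{N}^d$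 amounts to an arithmetic patch of size $k$ with orientation $\mathbf{e}$. A set contains a $(k,\epsilon,\mathbf{v})$-AP if some subset of it is one. $r_{k,d}(N)$ is the largest cardinality of a set $A\subseteq\{1,\ldots,N\}^d$ that does not contain any arithmetic patch of size $k$ (any scale $\Delta>0$) with orientation $\mathbf{e}=\{e_1,\ldots,e_d\}$. The Assouad dimension of $F\subseteq\mathbb{R}^d$ is $\dim_{\mathrm{A}}F=\inf\{\sigma\geq0 : \exists C>0\ \forall r>0\ \forall R>r\ \forall x\in F,\ N(B(x,R)\cap F,r)\leq C(R/r)^\sigma\}$, where $B(x,R)$ is the closed ball of radius $R$ centred at $x$ and $N(E,r)$ is the smallest cardinality of a family of sets of diameter at most $r$ covering $E$. $\dim_{\mathrm{H}}$ is the Hausdorff dimension. $D_{\mathrm{A}}(k,\epsilon,d,d)=\sup\{\dim_{\mathrm{A}}F : F\subseteq\mathbb{R}^d$ does not contain any $(k,\epsilon,\mathbf{v})$-APs for some set of orthogonal unit vectors $\mathbf{v}=\{v_1,\ldots,v_d\}\}$. $D_{\mathrm{H}}(k,\epsilon,d,d)=\sup\{\dim_{\mathrm{H}}F : F\subset\mathbb{R}^d$ is compact and does not contain any $(k,\epsilon,\mathbf{v})$-APs for some set of orthogonal unit vectors $\mathbf{v}=\{v_1,\ldots,v_d\}\}$. $D_{\mathrm{S}}(k,\epsilon,d,d)=\sup\{\dim_{\mathrm{H}}F\}$, the supremum over all compact $F\subset\mathbb{R}^d$ such that $F$ is the attractor (the nonempty compact set with $F=\bigcup_{i=1}^n f_i(F)$)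 of a finite iterated function system $\{f_1,\ldots,f_n\}$ of contracting similarities of $\mathbb{R}^d$ satisfying the open set condition (there is a nonempty bounded open $V\subset\mathbb{R}^d$ with $V\supseteq\bigcup_{i=1}^n f_i(V)$, the union being pairwise disjoint), and $F$ does not contain any $(k,\epsilon,\{e_1,\ldots,e_d\})$-APs. *)

(* Defs.v *)
From HB Require Import structures.
From mathcomp Require Import all_boot all_order all_algebra finmap.
From mathcomp Require Import all_classical all_reals all_analysis.

Set Implicit Arguments.
Unset Strict Implicit.
Unset Printing Implicit Defensive.

Import Order.TTheory GRing.Theory Num.Theory.
Import numFieldNormedType.Exports.

Local Open Scope classical_set_scope.
Local Open Scope ring_scope.

(* R^d is 'rV[R]_d with its library topology. The library norm there is the
   sup norm, which induces the same topology; every metric notion below uses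
   the Euclidean norm instead. *)

Definition dotv (R : realType) (d : nat) (x y : 'rV[R]_d) : R :=
  \sum_(i < d) x 0 i * y 0 i.

Definition enorm (R : realType) (d : nat) (x : 'rV[R]_d) : R :=
  Num.sqrt (dotv x x).

Definition eball (R : realType) (d : nat) (x : 'rV[R]_d) (r : R) :
    set 'rV[R]_d :=
  [set y | enorm (y - x) <= r].

(* The diameter of the empty set is 0. *)
Definition diam (R : realType) (d : nat) (E : set 'rV[R]_d) : \bar R :=
  maxe 0%E (ereal_sup [set (enorm (x - y))%:E | x in E & y in E]).

(* Arithmetic patches and (k, eps, v)-APs *)

Definition orthonormal_vectors (R : realType) (d : nat)
    (v : 'I_d -> 'rV[R]_d) : Prop :=
  (forall i, enorm (v i) = 1) /\ (forall i j, i != j -> dotv (v i) (v j) = 0).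

Definition std_basis (R : realType) (d : nat) : 'I_d -> 'rV[R]_d :=
  fun i => delta_mx 0 i.

Definition is_patch (R : realType) (d k : nat) (Delta : R)
    (v : 'I_d -> 'rV[R]_d) (P : set 'rV[R]_d) : Prop :=
  exists t : 'rV[R]_d,
    P = range (fun x : {ffun 'I_d -> 'I_k} =>
                 t + Delta *: \sum_(i < d) (x i)%:R *: v i).

Definition contains_patch (R : realType) (d k : nat)
    (v : 'I_d -> 'rV[R]_d) (A : set 'rV[R]_d) : Prop :=
  exists (Delta : R) (P : set 'rV[R]_d),
    [/\ 0 < Delta, is_patch k Delta v P & P `<=` A].

(* Extended reals make the infimum over an empty Q equal to +oo. *)
Definition is_AP (R : realType) (d k : nat) (eps : R)
    (v : 'I_d -> 'rV[R]_d) (Q : set 'rV[R]_d) : Prop :=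
  exists (Delta : R) (P : set 'rV[R]_d),
    [/\ 0 < Delta, is_patch k Delta v P
      & (ereal_sup [set ereal_inf [set (enorm (x - y))%:E | y in Q] | x in P]
           <= (eps * Delta)%:E)%E].

Definition contains_AP (R : realType) (d k : nat) (eps : R)
    (v : 'I_d -> 'rV[R]_d) (F : set 'rV[R]_d) : Prop :=
  exists2 Q : set 'rV[R]_d, Q `<=` F & is_AP k eps v Q.

(* Subsets of {1, 2, ...}^d *)

Definition pos_lattice (d : nat) : set 'rV[nat]_d :=
  [set x : 'rV[nat]_d | forall i, (0 < x ord0 i)%N].
Arguments pos_lattice d : clear implicits.

Definition box (d N : nat) : set 'rV[nat]_d :=
  [set x : 'rV[nat]_d | forall i, (1 <= x ord0 i <= N)%N].
Arguments box d N : clear implicits.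

Definition embed (R : realType) (d : nat) (x : 'rV[nat]_d) : 'rV[R]_d :=
  map_mx (fun n : nat => n%:R) x.

(* [fset_set] returns the empty finite set on infinite sets, so its uses below
   rely on this. *)
Lemma finite_box (d N : nat) : finite_set (box d N).
Proof.
apply: (@sub_finite_set _ _
  (range (fun x : 'rV['I_N.+1]_d => map_mx (@nat_of_ord N.+1) x))).
  move=> x xN; exists (map_mx inord x) => //.
  apply/rowP => i; rewrite !mxE inordK// ltnS.
  by have /andP[] := xN i.
exact/finite_image/finite_finset.
Qed.

Definition density_seq (R : realType) (d : nat) (A : set 'rV[nat]_d)
    (N : nat) : R :=
  #|` fset_set (A `&` box d N)|%:R / N%:R ^+ d.

(* The real field R is the one in which the scales of patches live. *)
Definition r_ (R : realType) (k d N : nat) : nat :=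
  \max_(A <- fpowerset (fset_set (box d N))
        | `[< ~ contains_patch k (@std_basis R d) (@embed R d @` [set` A]) >])
    #|` A|.

(* Dimensions *)

Definition covering_number (R : realType) (d : nat) (E : set 'rV[R]_d)
    (r : R) : \bar R :=
  ereal_inf [set (n%:R)%:E | n in [set n : nat |
    exists U : 'I_n -> set 'rV[R]_d,
      (forall i, (diam (U i) <= r%:E)%E) /\ E `<=` \bigcup_i U i]].

Definition assouad_dim (R : realType) (d : nat) (F : set 'rV[R]_d) : \bar R :=
  ereal_inf [set sigma%:E | sigma in [set sigma : R | 0 <= sigma /\
    exists2 C : R, 0 < C &
      forall r R0 : R, 0 < r -> r < R0 -> forall x, F x ->
        (covering_number (eball x R0 `&` F) r
           <= (C * (R0 / r) `^ sigma)%:E)%E]].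

(* diam(U)^s, where the empty set contributes 0 even for s = 0 (a nonempty
   set of diameter 0 contributes 0^0 = 1 for s = 0). *)
Definition hgauge (R : realType) (d : nat) (s : R) (U : set 'rV[R]_d) :
    \bar R :=
  if `[< U = set0 >] then 0%E else poweR (diam U) s.

Definition hausdorff_content (R : realType) (d : nat) (s delta : R)
    (F : set 'rV[R]_d) : \bar R :=
  ereal_inf [set (\sum_(0 <= i <oo) hgauge s (U i))%E |
    U in [set U : nat -> set 'rV[R]_d |
      (forall i, (diam (U i) <= delta%:E)%E) /\ F `<=` \bigcup_i U i]].

Definition hausdorff_measure (R : realType) (d : nat) (s : R)
    (F : set 'rV[R]_d) : \bar R :=
  ereal_sup [set hausdorff_content s delta F |
    delta in [set delta : R | 0 < delta]].

Definition hausdorff_dim (R : realType) (d : nat) (F : set 'rV[R]_d) :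
    \bar R :=
  ereal_inf [set s%:E |
    s in [set s : R | 0 <= s /\ hausdorff_measure s F = 0%E]].

(* Self-similar sets *)

Definition contracting_similarity (R : realType) (d : nat)
    (f : 'rV[R]_d -> 'rV[R]_d) : Prop :=
  exists c : R, [/\ 0 < c, c < 1 &
    forall x y, enorm (f x - f y) = c * enorm (x - y)].

Definition is_attractor (R : realType) (d n : nat)
    (f : 'I_n -> 'rV[R]_d -> 'rV[R]_d) (F : set 'rV[R]_d) : Prop :=
  [/\ F !=set0, compact F & F = \bigcup_i (f i @` F)].

Definition open_set_condition (R : realType) (d n : nat)
    (f : 'I_n -> 'rV[R]_d -> 'rV[R]_d) : Prop :=
  exists V : set 'rV[R]_d,
    [/\ V !=set0, bounded_set V, open V,
        \bigcup_i (f i @` V) `<=` V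
      & forall i j, i != j -> (f i @` V) `&` (f j @` V) = set0].

Definition self_similar_osc (R : realType) (d : nat) (F : set 'rV[R]_d) :
    Prop :=
  exists (n : nat) (f : 'I_n -> 'rV[R]_d -> 'rV[R]_d),
    [/\ forall i, contracting_similarity (f i),
        open_set_condition f & is_attractor f F].

(* D_X k eps d is the quantity D_X(k, eps, d, d). *)

Definition D_A (R : realType) (k : nat) (eps : R) (d : nat) : \bar R :=
  ereal_sup [set assouad_dim F | F in [set F : set 'rV[R]_d |
    exists2 v : 'I_d -> 'rV[R]_d,
      orthonormal_vectors v & ~ contains_AP k eps v F]].

Definition D_H (R : realType) (k : nat) (eps : R) (d : nat) : \bar R :=
  ereal_sup [set hausdorff_dim F | F in [set F : set 'rV[R]_d | compact F /\
    exists2 v : 'I_d -> 'rV[R]_d,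
      orthonormal_vectors v & ~ contains_AP k eps v F]].

Definition D_S (R : realType) (k : nat) (eps : R) (d : nat) : \bar R :=
  ereal_sup [set hausdorff_dim F | F in [set F : set 'rV[R]_d |
    self_similar_osc F /\ ~ contains_AP k eps (@std_basis R d) F]].

(* eps^(d - D), for an extended real D. For k >= 2 and 0 < eps < 1/2 the three
   suprema above lie in [0, d] (a single point contains no AP), so [fine] only
   casts a finite extended real to R. *)
Definition eps_pow_codim (R : realType) (eps : R) (d : nat) (D : \bar R) : R :=
  eps `^ (d%:R - fine D).

(* Main.v *)
(** The cycle is (i) => (ii) => (v) => (iv) => (iii) => (ii) => (i).

    (ii) => (v): let [F] contain no (k, eps, v)-AP and take [M >= d / eps]. Cut
    a cube aligned with [v] into [(M N)^d] equal cells. Two cells with the same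
    residue modulo [M] are so far apart that a patch of cells of one residue
    class meeting [F] would give a (k, eps, v)-AP, so at most [M^d r(N)] cells
    meet [F]. Iterating, [dim_A F <= ln (M^d r(N)) / ln (M N)], which gives
    [eps^(d - D_A) <= (r(N) / N^d)^(1/2)] once [eps] is small in terms of [N].

    (iii) => (ii): let [S] be an extremal patch-free subset of [{1..N}^d] and
    [L = 8 (k + 1) N + 1]. The set of sums [a_1 / L + a_2 / L^2 + ...] with
    digits in [S] is self-similar. An approximate AP in it, zoomed in until its
    points have different first digits, rounds to a patch in [S], so there is
    none for [eps = 1 / (8 L)]. Its Hausdorff dimension is at least
    [ln r(N) / ln L], whence [eps^(d - D_S) >= (r(N) / L^d)^2].

    (i) => (ii): extremal sets placed in rapidly spaced blocks form a set of
    positive upper density, and no three-term progression meets two blocks. *)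
Require Import Defs.
From HB Require Import structures.
From mathcomp Require Import all_boot all_order all_algebra finmap.
From mathcomp Require Import all_classical all_reals all_analysis.
From mathcomp Require Import lra zify ring.

Import Order.TTheory GRing.Theory Num.Theory.
Import numFieldNormedType.Exports.

Local Open Scope classical_set_scope.
Local Open Scope ring_scope.

Set Implicit Arguments.
Unset Strict Implicit.
Unset Printing Implicit Defensive.

(** * Euclidean geometry in an orthonormal frame *)

Lemma dotvv_ge0 (R : realType) (d : nat) (x : 'rV[R]_d) : 0 <= dotv x x.
Proof. by apply: sumr_ge0 => i _; rewrite -expr2 sqr_ge0. Qed.

Lemma coord_le_enorm (R : realType) (d : nat) (x : 'rV[R]_d) (i : 'I_d) :
  `|x 0 i| <= enorm x.
Proof.
rewrite -sqrtr_sqr ler_wsqrtr// /dotv (bigD1 i)//= -expr2 lerDl.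
by apply: sumr_ge0 => j _; rewrite -expr2 sqr_ge0.
Qed.

(** The factor [d] in place of its square root keeps all later constants free of roots. *)
Lemma enorm_le_coord (R : realType) (d : nat) (x : 'rV[R]_d) (s : R) :
  (forall i, `|x 0 i| <= s) -> enorm x <= d%:R * s.
Proof.
(* For [d = 0] nothing forces [s] to be nonnegative, but both sides vanish. *)
case: d x => [|d] x xs; first by rewrite /enorm /dotv big_ord0 sqrtr0 mul0r.
have s0 : 0 <= s by apply: le_trans (xs ord0).
have ds0 : 0 <= d.+1%:R * s by apply: mulr_ge0.
rewrite -[leRHS]ger0_norm// -sqrtr_sqr ler_wsqrtr//.
apply: (@le_trans _ _ (\sum_(i < d.+1) s ^+ 2)).
  by apply: ler_sum => i _; rewrite -expr2 -real_normK ?num_real// lerXn2r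
    ?nnegrE.
rewrite sumr_const card_ord exprMn -[leLHS]mulr_natl ler_wpM2r ?sqr_ge0//.
by rewrite -natrX ler_nat; lia.
Qed.

Lemma enormZ (R : realType) (d : nat) (c : R) (x : 'rV[R]_d) :
  enorm (c *: x) = `|c| * enorm x.
Proof.
rewrite /enorm -sqrtr_sqr -sqrtrM ?sqr_ge0//; congr Num.sqrt.
rewrite /dotv mulr_sumr; apply: eq_bigr => i _; rewrite !mxE; ring.
Qed.

Lemma enormB (R : realType) (d : nat) (x y : 'rV[R]_d) :
  enorm (x - y) = enorm (y - x).
Proof. by rewrite -opprB -scaleN1r enormZ normrN1 mul1r. Qed.

(** Passing to these coordinates reduces an arbitrary orientation to the axis-parallel one. *)
Definition frame (R : realType) (d : nat) (v : 'I_d -> 'rV[R]_d)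
    (y : 'rV[R]_d) : 'rV[R]_d := \row_i dotv y (v i).

Lemma frameE (R : realType) (d : nat) (v : 'I_d -> 'rV[R]_d) (y : 'rV[R]_d) :
  frame v y = y *m (\matrix_(i, j) v i 0 j)^T.
Proof. by apply/rowP => i; rewrite !mxE; apply: eq_bigr => j _;
  rewrite !mxE. Qed.

Lemma orthonormal_mx (R : realType) (d : nat) (v : 'I_d -> 'rV[R]_d) :
  orthonormal_vectors v ->
  (\matrix_(i, j) v i 0 j) *m (\matrix_(i, j) v i 0 j)^T = 1%:M.
Proof.
move=> [v1 v0]; apply/matrixP => i j; rewrite !mxE.
under eq_bigr do rewrite !mxE.
have [->|ij] := eqVneq i j; last exact: v0.
have := v1 j; rewrite /enorm => vj.
by rewrite -[LHS](sqr_sqrtr (dotvv_ge0 (v j))) vj expr1n.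
Qed.

Lemma enorm_frame (R : realType) (d : nat) (v : 'I_d -> 'rV[R]_d)
    (y : 'rV[R]_d) :
  orthonormal_vectors v -> enorm (frame v y) = enorm y.
Proof.
(* Orthonormality says [V *m V^T = 1], while preservation of the norm needs [V^T *m V = 1]; the two
   agree because [V] is square. *)
move=> /orthonormal_mx /mulmx1C vv; rewrite /enorm; congr Num.sqrt.
have dotE (z : 'rV[R]_d) : dotv z z = (z *m z^T) 0 0.
  by rewrite mxE; apply: eq_bigr => i _; rewrite !mxE.
by rewrite !dotE frameE trmx_mul trmxK mulmxA -(mulmxA y) vv mulmx1.
Qed.

Lemma frameB (R : realType) (d : nat) (v : 'I_d -> 'rV[R]_d) (x y : 'rV[R]_d) :
  frame v (x - y) = frame v x - frame v y.
Proof. by rewrite !frameE mulmxBl. Qed.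

Lemma frameB_coord (R : realType) (d : nat) (v : 'I_d -> 'rV[R]_d)
    (x y : 'rV[R]_d) i : frame v (x - y) 0 i = frame v x 0 i - frame v y 0 i.
Proof. by rewrite frameB !mxE. Qed.

Lemma frame_sum (R : realType) (d : nat) (v : 'I_d -> 'rV[R]_d)
    (c : 'I_d -> R) :
  orthonormal_vectors v -> frame v (\sum_i c i *: v i) = \row_i c i.
Proof.
move=> /orthonormal_mx vv.
have -> : \sum_i c i *: v i = (\row_i c i) *m (\matrix_(i, j) v i 0 j).
  apply/rowP => j; rewrite !mxE summxE.
  by apply: eq_bigr => i _; rewrite !mxE.
by rewrite frameE -mulmxA vv mulmx1.
Qed.

Lemma orthonormal_std_basis (R : realType) (d : nat) :
  orthonormal_vectors (@std_basis R d).
Proof.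
have dotE (i j : 'I_d) : dotv (std_basis R i) (std_basis R j) = (i == j)%:R.
  rewrite /dotv (bigD1 i)//= big1 ?addr0; last first.
    by move=> l /negPf li; rewrite !mxE li mul0r.
  by rewrite !mxE !eqxx mul1r.
split=> [i|i j /negPf ij]; last by rewrite dotE ij.
by rewrite /enorm dotE eqxx sqrtr1.
Qed.

Lemma sum_std_basis (R : realType) (d : nat) (c : 'I_d -> R) :
  \sum_i c i *: std_basis R i = \row_i c i.
Proof.
by rewrite [RHS]row_sum_delta; apply: eq_bigr => i _; rewrite mxE.
Qed.

(** [T] holds the frame coordinates of the corner of the patch, and an error of [s] per coordinate
    costs at most [d * s] in Euclidean norm. *)
Lemma frame_contains_AP (R : realType) (d k : nat) (eps Delta s : R)
    (v : 'I_d -> 'rV[R]_d) (F : set 'rV[R]_d) (T : 'rV[R]_d)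
    (y : {ffun 'I_d -> 'I_k} -> 'rV[R]_d) :
  orthonormal_vectors v -> 0 < Delta -> d%:R * s <= eps * Delta ->
  (forall x, F (y x)) ->
  (forall x i, `|frame v (y x) 0 i - (T 0 i + Delta * (x i)%:R)| <= s) ->
  contains_AP k eps v F.
Proof.
move=> vo D0 ds Fy ys; exists (range y); first by move=> _ [x _ <-].
pose t := \sum_i T 0 i *: v i.
exists Delta, (range (fun x : {ffun 'I_d -> 'I_k} =>
                 t + Delta *: \sum_(i < d) (x i)%:R *: v i)).
split => //; first by exists t.
apply: ge_ereal_sup => _ [_ [x _ <-] <-].
apply: ereal_inf_le; exists (enorm (t + Delta *: \sum_(i < d) (x i)%:R *: v i
  - y x))%:E.
  by exists (y x) => //; exists x.
rewrite lee_fin (le_trans _ ds)// enormB -(enorm_frame _ vo).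
apply: enorm_le_coord => i.
suff -> : frame v (y x - (t + Delta *: \sum_(j < d) (x j)%:R *: v j)) 0 i =
  frame v (y x) 0 i - (T 0 i + Delta * (x i)%:R) by [].
rewrite frameB mxE; congr (_ + _); rewrite mxE; congr (- _).
rewrite scaler_sumr /t -big_split/=.
under eq_bigr do rewrite scalerA -scalerDl.
by rewrite frame_sum// mxE.
Qed.

(** The infimum in [is_AP] need not be attained, so the points exist only for each [eps' > eps].
    Since [Delta] and [T] come first, [eps'] may be chosen in terms of [Delta]. *)
Lemma contains_AP_approx (R : realType) (d k : nat) (eps : R)
    (F : set 'rV[R]_d) :
  contains_AP k eps (@std_basis R d) F ->
  exists (Delta : R) (T : 'rV[R]_d), 0 < Delta /\ forall eps', eps < eps' ->
  exists y : {ffun 'I_d -> 'I_k} -> 'rV[R]_d, (forall x, F (y x)) /\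
    forall x i, `|y x 0 i - (T 0 i + Delta * (x i)%:R)| <= eps' * Delta.
Proof.
move=> [Q QF [Delta [P [D0 [T PE] PQ]]]]; exists Delta, T; split=> // eps' ee.
have /choice[y yP] : forall x : {ffun 'I_d -> 'I_k}, exists y, F y /\
    forall i, `|y 0 i - (T 0 i + Delta * (x i)%:R)| <= eps' * Delta.
  move=> x; pose p := T + Delta *: \sum_(i < d) (x i)%:R *: std_basis R i.
  have : (ereal_inf [set (enorm (p - y))%:E | y in Q] < (eps' * Delta)%:E)%E.
    apply: le_lt_trans (_ : ((eps * Delta)%:E < _)%E); last first.
      by rewrite lte_fin ltr_pM2r.
    apply: le_trans PQ; apply: ereal_sup_ubound.
    by exists p => //; rewrite PE; exists x.
  move=> /ereal_inf_lt[_ [y Qy <-]]; rewrite lte_fin => py.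
  exists y; split; first exact: QF.
  move=> i; apply: le_trans (ltW py); rewrite enormB.
  apply: le_trans (coord_le_enorm _ i).
  by rewrite /p sum_std_basis !mxE.
by exists y; split => x; have [] := yP x.
Qed.

(** * Patches of lattice points *)

Lemma natr_eq_of_dist_lt1 (R : realType) (m n : nat) :
  `|m%:R - n%:R : R| < 1 -> m = n.
Proof.
rewrite ltr_distl => /andP[mn nm].
have : (m < n + 1)%N by rewrite -(ltr_nat R) natrD; lra.
have : (n < m + 1)%N by rewrite -(ltr_nat R) natrD; lra.
lia.
Qed.

(** [t] and [b] are read off from [a] at the constant indices 0 and 1. As [b] is within [2 * eta] of
    [Delta], each [a x] differs from its predicted lattice point by at most [2 * eta] plus [k - 1]
    times [2 * eta], which is less than 1, and both are integral. The step [b] may be 0. *)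
Lemma round_patch (R : realType) (d k : nat) (Delta eta : R) (T : 'rV[R]_d)
    (a : {ffun 'I_d -> 'I_k} -> 'rV[nat]_d) :
  (0 < d)%N -> (1 < k)%N -> 0 < Delta -> k.+1%:R * (2 * eta) < 1 ->
  (forall x i, `|(a x 0 i)%:R - (T 0 i + Delta * (x i)%:R)| <= eta) ->
  exists (t : 'rV[nat]_d) (b : nat), `|b%:R - Delta| <= 2 * eta /\
    forall x, a x = \row_i (t ord0 i + b * x i)%N.
Proof.
case: d T a => // d T a _; case: k a => [//|[//|k]] a _ D0 keta aT.
pose x0 : {ffun 'I_d.+1 -> 'I_k.+2} := [ffun=> ord0].
pose x1 : {ffun 'I_d.+1 -> 'I_k.+2} := [ffun=> inord 1].
have eta0 : 0 <= eta by apply: le_trans (aT x0 ord0).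
have k3 : 3 <= k.+3%:R :> R by rewrite ler_nat.
have := aT x0 ord0; have := aT x1 ord0; rewrite !ffunE/= inordK// !ler_norml.
set p := (a x0 ord0 ord0)%:R; set q :=
  (a x1 ord0 ord0)%:R => /andP[h1 h2] /andP[h3 h4].
have eta1 : 2 * eta < 1.
  by apply: le_lt_trans keta; rewrite ler_peMl ?mulr_ge0//; lra.
(* The difference is at least [Delta - 2 * eta > -1], so the truncated subtraction defining [b]
   loses nothing. *)
have pq : (a x0 ord0 ord0 <= a x1 ord0 ord0)%N.
  suff : (a x0 ord0 ord0 < a x1 ord0 ord0 + 1)%N by rewrite addn1.
  by rewrite -(ltr_nat R) natrD; lra.
exists (a x0), (a x1 ord0 ord0 - a x0 ord0 ord0)%N.
have bD : `|(a x1 ord0 ord0 - a x0 ord0 ord0)%:R - Delta| <= 2 * eta.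
  by rewrite natrB// ler_norml; apply/andP; split; lra.
split=> // x; apply/rowP => i; rewrite mxE; apply: (@natr_eq_of_dist_lt1 R).
move: bD; set b : nat := (_ - _)%N => bD.
have := aT x i; have := aT x0 i; rewrite !ffunE/= => ax0 ax.
have -> : (a x 0 i)%:R - (a x0 ord0 i + b * x i)%:R =
   ((a x 0 i)%:R - (T 0 i + Delta * (x i)%:R)) -
   ((a x0 0 i)%:R - (T 0 i + Delta * 0)) - (b%:R - Delta) * (x i)%:R :> R.
  by rewrite natrD natrM; ring.
apply: le_lt_trans keta; apply: le_trans (ler_normB _ _) _.
rewrite normrM normr_nat.
have xk : (x i)%:R <= k.+1%:R :> R by rewrite ler_nat -ltnS.
have : `|b%:R - Delta| * (x i)%:R <= 2 * eta * k.+1%:R by rewrite ler_pM.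
have := ler_normB ((a x 0 i)%:R - (T 0 i + Delta * (x i)%:R))
   ((a x0 0 i)%:R - (T 0 i + Delta * 0)).
have -> : k.+3%:R = k.+1%:R + 2 :> R by rewrite -addn2 natrD.
lra.
Qed.

(** A patch with integral corner and scale, so that combinatorial arguments do not mention [R];
    [embed_patchP] identifies it with the real notion. *)
Definition lattice_patch (k d : nat) (A : set 'rV[nat]_d) : Prop :=
  exists (t : 'rV[nat]_d) (m : nat), (0 < m)%N /\
    forall x : {ffun 'I_d -> 'I_k}, A (\row_i (t ord0 i + m * x i)%N).

Lemma contains_patch_AP0 (R : realType) (d k : nat) (v : 'I_d -> 'rV[R]_d)
    (A : set 'rV[R]_d) : contains_patch k v A -> contains_AP k 0 v A.
Proof.
move=> [Delta [P [D0 PP PA]]]; exists P => //; exists Delta, P; split => //.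
rewrite mul0r; apply: ge_ereal_sup => _ [x Px <-]; apply: ereal_inf_lbound.
by exists x => //; rewrite subrr -(scale0r x) enormZ normr0 mul0r.
Qed.

Lemma lattice_patch_embed (R : realType) (d k : nat) (A : set 'rV[nat]_d) :
  lattice_patch k A -> contains_patch k (@std_basis R d) (@embed R d @` A).
Proof.
move=> [t [m [m0 tA]]]; exists m%:R, (range (fun x : {ffun 'I_d -> 'I_k} =>
   embed R t + m%:R *: \sum_(i < d) (x i)%:R *: std_basis R i)).
split; [by rewrite ltr0n| by exists (embed R t)|].
move=> _ [x _ <-]; exists (\row_i (t ord0 i + m * x i)%N) => //.
by rewrite sum_std_basis; apply/rowP => i; rewrite !mxE natrD natrM.
Qed.

Lemma embed_AP0_lattice_patch (R : realType) (d k : nat)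
    (A : set 'rV[nat]_d) : (0 < d)%N -> (1 < k)%N ->
  contains_AP k 0 (@std_basis R d) (@embed R d @` A) -> lattice_patch k A.
Proof.
move=> d0 k1 /contains_AP_approx[Delta [T [D0 approx]]].
(* The second bound is the hypothesis of [round_patch]; the third puts the integral step within
   [Delta / 2] of [Delta], so that it is positive. *)
have [eta [eta0 keta etaD]] : exists eta : R,
    [/\ 0 < eta, k.+1%:R * (2 * eta) < 1 & 4 * eta <= Delta].
  have : 0 < k.+1%:R :> R by [].
  set K : R := k.+1%:R => K0; exists (Num.min (4 * K)^-1 (Delta / 4)); split.
  - by rewrite lt_min invr_gt0 divr_gt0// mulr_gt0.
  - apply: (@le_lt_trans _ _ (K * (2 * (4 * K)^-1))).
      by rewrite ler_pM2l// ler_pM2l// ge_min lexx.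
    have -> : K * (2 * (4 * K)^-1) = 2^-1 by field; rewrite gt_eqF.
    lra.
  - by rewrite mulrC -ler_pdivlMr// ge_min lexx orbT.
have [y [Ay yT]] := approx (eta / Delta) (divr_gt0 eta0 D0).
rewrite divfK ?gt_eqF// in yT.
have /choice[a aP] : forall x, exists a, A a /\ embed R a = y x.
  by move=> x; have [a Aa ay] := Ay x; exists a.
have [|t [b [bD ta]]] := @round_patch R d k Delta eta T a d0 k1 D0 keta.
  by move=> x i; have := yT x i; rewrite -(aP x).2 mxE.
exists t, b; split; last by move=> x; rewrite -ta; exact: (aP x).1.
rewrite -(ltr_nat R); move: bD; rewrite ler_norml => /andP[]; lra.
Qed.

Lemma embed_patchP (R : realType) (d k : nat) (A : set 'rV[nat]_d) :
  (0 < d)%N -> (1 < k)%N ->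
  contains_patch k (@std_basis R d) (@embed R d @` A) <-> lattice_patch k A.
Proof.
move=> d0 k1; split; last exact: lattice_patch_embed.
by move=> /contains_patch_AP0; exact: embed_AP0_lattice_patch.
Qed.

Lemma lattice_patch_sub (k d : nat) (A B : set 'rV[nat]_d) :
  A `<=` B -> lattice_patch k A -> lattice_patch k B.
Proof. by move=> AB [t [m [m0 tA]]]; exists t, m; split=> // x; exact/AB. Qed.

(** * Extremal patch-free subsets of the box *)

Lemma card_le_r (R : realType) (k d N : nat) (S : {fset 'rV[nat]_d}) :
  (0 < d)%N -> (1 < k)%N -> [set` S] `<=` box d N ->
  ~ lattice_patch k [set` S] -> (#|` S| <= r_ R k d N)%N.
Proof.
move=> d0 k1 SN nS; rewrite /r_; apply: (@leq_bigmax_seq _ _ _ _ S).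
  rewrite fpowersetE; apply/fsubsetP => x xS.
  by rewrite in_fset_set ?inE; [exact: SN|exact: finite_box].
by apply/asboolP; rewrite embed_patchP.
Qed.

Lemma r_attained (R : realType) (k d N : nat) : (0 < d)%N -> (1 < k)%N ->
  exists S : {fset 'rV[nat]_d}, [/\ [set` S] `<=` box d N,
    ~ lattice_patch k [set` S] & #|` S| = r_ R k d N].
Proof.
move=> d0 k1; rewrite /r_ big_seq_cond.
(* Being the size of a patch-free subset of the box is stable under maxima, and the empty set
   accounts for the initial value 0. *)
apply: (big_ind (fun m => exists S : {fset 'rV[nat]_d}, [/\ [set` S] `<=` box
  d N,
    ~ lattice_patch k [set` S] & #|` S| = m])).
- exists fset0; split; [by move=> x| |by rewrite cardfs0].
  by case: k k1 => // k _ [t [m [_ /(_ [ffun=> ord0])]]].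
- by move=> m n Sm Sn; case: (leqP m n).
- move=> S /andP[]; rewrite fpowersetE => /fsubsetP SN /asboolP nS.
  exists S; split => //; last by rewrite -(embed_patchP R).
  by move=> x /SN; rewrite in_fset_set ?inE//; exact: finite_box.
Qed.

Lemma r_gt0 (R : realType) (k d N : nat) : (0 < d)%N -> (1 < k)%N ->
  (0 < N)%N -> (0 < r_ R k d N)%N.
Proof.
move=> d0 k1 N0; rewrite -(cardfs1 (\row_(i < d) 1%N)).
apply: card_le_r => // [x|].
  by rewrite /= inE => /eqP -> i; rewrite mxE N0.
case: d d0 => // d _; case: k k1 => [//|[//|k]] _ [t [m [m0 tA]]].
have := tA [ffun=> ord0]; have := tA [ffun=> inord 1].
rewrite /= !inE => /eqP/rowP/(_ ord0) h /eqP/rowP/(_ ord0).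
by move: h; rewrite !mxE !ffunE inordK//=; lia.
Qed.

Lemma card_box_le (d N : nat) (S : {fset 'rV[nat]_d}) :
  [set` S] `<=` box d N -> (#|` S| <= N ^ d)%N.
Proof.
(* For [N = 0] the box is empty unless [d = 0]; then it is a single point, in agreement with
   [0 ^ 0 = 1]. *)
case: N => [|N] SN.
  case: d S SN => [|d] S SN.
    rewrite expn0; apply: (@leq_trans #|` [fset (0 : 'rV[nat]_0)] |%fset);
      last by rewrite cardfs1.
    by apply: fsubset_leq_card; apply/fsubsetP => x _; rewrite inE thinmx0.
  rewrite exp0n// leqn0 cardfs_eq0; apply/eqP/fsetP => x; rewrite inE.
  by apply/negP => /SN/(_ ord0); rewrite andbC ltnNge leqn0; case: (x _ _).
pose f (x : 'rV[nat]_d) : {ffun 'I_d -> 'I_N.+1} :=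
  [ffun i => inord (x 0 i).-1].
have fI (x y : 'rV[nat]_d) : x \in S -> y \in S -> f x = f y -> x = y.
  move=> xS yS /ffunP xy; apply/rowP => i; have := xy i; rewrite !ffunE.
  have /andP[x1 x2] : (1 <= x 0%R i <= N.+1)%N := SN _ xS i.
  have /andP[y1 y2] : (1 <= y 0%R i <= N.+1)%N := SN _ yS i.
  move=> /(congr1 val)/=; rewrite !inordK //; lia.
rewrite -[N.+1]card_ord -[X in (_ ^ X)%N]card_ord -card_ffun cardT enumT.
rewrite -(size_map f) uniq_leq_size //.
  by rewrite map_inj_in_uniq ?fset_uniq// => x y; exact: fI.
by move=> z _; rewrite -enumT mem_enum.
Qed.

Lemma r_le (R : realType) (k d N : nat) : (0 < d)%N -> (1 < k)%N ->
  (r_ R k d N <= N ^ d)%N.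
Proof. by move=> d0 k1; have [S [SN _ <-]] := r_attained R N d0 k1;
  exact: card_box_le. Qed.

(** * Dimensions *)

Lemma norm_le_coord (R : realType) (d : nat) (x : 'rV[R]_d) (M : R) :
  0 <= M -> (forall i, `|x 0 i| <= M) -> `|x| <= M.
Proof.
move=> M0 xM; rewrite [leLHS]/Num.norm /= mx_normrE; apply/bigmax_leP;
  split=> //.
by move=> [i j] _ /=; rewrite ord1.
Qed.

Lemma coord_le_norm (R : realType) (d : nat) (x : 'rV[R]_d) (i : 'I_d) :
  `|x 0 i| <= `|x|.
Proof.
rewrite [leRHS]/Num.norm /= mx_normrE.
by apply/bigmax_geP; right => /=; exists (ord0, i).
Qed.

Lemma diam_ge0 (R : realType) (d : nat) (U : set 'rV[R]_d) :
  (0 <= diam U)%E.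
Proof. by rewrite /diam le_max lexx. Qed.

Lemma diam_le (R : realType) (d : nat) (U : set 'rV[R]_d) (s : R) :
  0 <= s -> (forall x y, U x -> U y -> enorm (x - y) <= s) ->
  (diam U <= s%:E)%E.
Proof.
move=> s0 Us; rewrite /diam ge_max lee_fin s0/=; apply: ge_ereal_sup.
by move=> _ [x Ux [y Uy <-]]; rewrite lee_fin Us.
Qed.

Lemma diam_set0 (R : realType) (d : nat) : diam (@set0 'rV[R]_d) = 0%E.
Proof. by apply/eqP; rewrite eq_le diam_ge0 andbT diam_le. Qed.

Lemma enorm_le_diam (R : realType) (d : nat) (U : set 'rV[R]_d) x y :
  U x -> U y -> ((enorm (x - y))%:E <= diam U)%E.
Proof.
move=> Ux Uy; rewrite /diam le_max; apply/orP; right.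
by apply: ereal_sup_ubound; exists x => //; exists y.
Qed.

Lemma ge0_lee_poweR (R : realType) (s : R) (a b : \bar R) :
  0 <= s -> (0 <= a)%E -> (a <= b)%E -> (a `^ s <= b `^ s)%E.
Proof.
move=> s0 a0 ab; apply: gt0_ler_poweR => //; rewrite in_itv/= leey andbT //.
exact: le_trans ab.
Qed.

Lemma hgauge_ge0 (R : realType) (d : nat) (s : R) (U : set 'rV[R]_d) :
  (0 <= hgauge s U)%E.
Proof. by rewrite /hgauge; case: ifP => // _; exact: poweR_ge0. Qed.

Lemma hgauge_set0 (R : realType) (d : nat) (s : R) :
  hgauge s (@set0 'rV[R]_d) = 0%E.
Proof. by rewrite /hgauge asboolT. Qed.

Lemma hgauge_le (R : realType) (d : nat) (s r : R) (U : set 'rV[R]_d) :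
  0 <= s -> (diam U <= r%:E)%E -> (hgauge s U <= (r `^ s)%:E)%E.
Proof.
move=> s0 Ur; rewrite /hgauge; case: ifP => _;
  first by rewrite lee_fin powR_ge0.
by rewrite -poweR_EFin ge0_lee_poweR// diam_ge0.
Qed.

Lemma hgauge_ge (R : realType) (d : nat) (s r : R) (U : set 'rV[R]_d) x y :
  0 <= s -> 0 <= r -> U x -> U y -> r <= enorm (x - y) ->
  ((r `^ s)%:E <= hgauge s U)%E.
Proof.
move=> s0 r0 Ux Uy rxy; rewrite /hgauge asboolF; last first.
  by move=> U0; rewrite U0 in Ux.
rewrite -poweR_EFin ge0_lee_poweR ?lee_fin//.
by apply: le_trans (enorm_le_diam Ux Uy); rewrite lee_fin.
Qed.

Lemma hausdorff_dim_ge0 (R : realType) (d : nat) (F : set 'rV[R]_d) :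
  (0 <= hausdorff_dim F)%E.
Proof. by apply: le_ereal_inf_tmp => _ [s [s0 _] <-]; rewrite lee_fin. Qed.

Lemma assouad_dim_ge0 (R : realType) (d : nat) (F : set 'rV[R]_d) :
  (0 <= assouad_dim F)%E.
Proof. by apply: le_ereal_inf_tmp => _ [s [s0 _] <-]; rewrite lee_fin. Qed.

Lemma hausdorff_content_ge0 (R : realType) (d : nat) (s delta : R)
    (F : set 'rV[R]_d) : (0 <= hausdorff_content s delta F)%E.
Proof.
apply: le_ereal_inf_tmp => _ [U _ <-]; apply: nneseries_ge0 => n _ _.
exact: hgauge_ge0.
Qed.

Lemma hausdorff_measure_eq0 (R : realType) (d : nat) (s : R)
    (F : set 'rV[R]_d) :
  (forall delta e : R, 0 < delta -> 0 < e ->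
     (hausdorff_content s delta F <= e%:E)%E) ->
  hausdorff_measure s F = 0%E.
Proof.
move=> Fe; apply/eqP; rewrite eq_le; apply/andP; split.
  apply: ge_ereal_sup => _ [delta d0 <-]; apply/lee_addgt0Pr => e e0.
  by rewrite add0e Fe.
apply: le_ereal_sup_tmp; exists (hausdorff_content s 1 F).
  by exists 1 => //=; exact: ltr01.
exact: hausdorff_content_ge0.
Qed.

Lemma hausdorff_content_le_cover (R : realType) (d n : nat) (s delta r : R)
    (F : set 'rV[R]_d) (U : 'I_n -> set 'rV[R]_d) :
  0 <= s -> 0 <= delta -> r <= delta -> (forall i, (diam (U i) <= r%:E)%E) ->
  F `<=` \bigcup_i U i -> (hausdorff_content s delta F <= (n%:R * r `^ s)%:E)%E.
Proof.
move=> s0 delta0 rd Ur FU.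
(* Padding the finite cover with empty sets is free: their gauge is 0 even for [s = 0]. *)
pose V (j : nat) : set 'rV[R]_d :=
  if insub j is Some i then U i else set0.
have Vout j : (n <= j)%N -> V j = set0.
  by move=> nj; rewrite /V insubF// ltnNge nj.
have Vin (i : 'I_n) : V i = U i.
  by rewrite /V; case: insubP => [i' _ /val_inj -> //|]; rewrite ltn_ord.
apply: ge_ereal_inf; exists (\sum_(0 <= i <oo) hgauge s (V i))%E.
  exists V => //; split=> [j|x /FU[i _ Ux]]; last by exists (val i) => //;
    rewrite Vin.
  rewrite /V; case: insubP => [i _ _|_]; last by rewrite diam_set0 lee_fin.
  by apply: le_trans (Ur i) _; rewrite lee_fin.
rewrite (nneseries_split 0 n); last by move=> j _; exact: hgauge_ge0.
rewrite [X in (_ + X)%E]eseries0 ?adde0; last first.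
  by move=> j; rewrite add0n => nj _; rewrite Vout// hgauge_set0.
rewrite add0n big_mkord.
apply: (@le_trans _ _ (\sum_(i < n) (r `^ s)%:E)%E).
  by apply: lee_sum => i _; rewrite Vin hgauge_le.
by rewrite sumEFin sumr_const card_ord mulr_natl.
Qed.

(** With the radius [R0] fixed, about [(R0 / r) ^ sigma] sets of diameter [r] cover [F], so the
    content for exponent [sigma + e] is at most a constant times [r ^ e], which tends to 0 with
    [r]. *)
Lemma hausdorff_dim_le_assouad (R : realType) (d : nat) (F : set 'rV[R]_d)
    (x : 'rV[R]_d) (R0 : R) :
  0 < R0 -> F x -> F `<=` eball x R0 -> (hausdorff_dim F <= assouad_dim F)%E.
Proof.
move=> R00 Fx FR0; apply: le_ereal_inf_tmp => _ [sigma [sigma0 [C C0 FC]] <-].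
apply/lee_addgt0Pr => e e0; rewrite -EFinD; apply: ereal_inf_lbound.
have se0 : 0 <= sigma + e by rewrite addr_ge0// ltW.
exists (sigma + e) => //; split => //.
apply: hausdorff_measure_eq0 => delta eta delta0 eta0.
(* The factor 2 makes the bound on the covering number strict, so that an actual cover can be
   extracted from the infimum. *)
pose K := 2 * C * R0 `^ sigma.
have K0 : 0 < K by rewrite !mulr_gt0// powR_gt0.
pose r := Num.min (Num.min delta (R0 / 2)) ((eta / K) `^ e^-1).
have r0 : 0 < r by rewrite !lt_min delta0 divr_gt0//= powR_gt0 ?divr_gt0.
have rd : r <= delta by rewrite !ge_min lexx.
have rR0 : r < R0.
  by rewrite !gt_min [X in _ || X || _](_ : _ = true) ?orbT//; lra.
have re : r `^ e <= eta / K.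
  have -> : eta / K = ((eta / K) `^ e^-1) `^ e.
    by rewrite -powRrM mulVf ?gt_eqF// powRr1// divr_ge0// ltW.
  by rewrite ge0_ler_powR ?nnegrE ?powR_ge0 ?(ltW e0) ?(ltW r0)// ge_min lexx
    orbT.
have : (covering_number (eball x R0 `&` F) r < (2 * C * (R0 / r) `^
  sigma)%:E)%E.
  apply: le_lt_trans (FC r R0 r0 rR0 x Fx) _; rewrite lte_fin.
  have : 0 < C * (R0 / r) `^ sigma by rewrite mulr_gt0// powR_gt0// divr_gt0.
  by rewrite -mulrA; lra.
move=> /ereal_inf_lt[_ [n [U [Ur FU]] <-]]; rewrite lte_fin => nC.
have FU' : F `<=` \bigcup_i U i by move=> y Fy; apply: FU; split => //;
  exact: FR0.
apply: le_trans (hausdorff_content_le_cover se0 (ltW delta0) rd Ur FU') _.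
rewrite lee_fin powRD; last by rewrite implybE (gt_eqF r0) orbT.
apply: (@le_trans _ _ (2 * C * (R0 / r) `^ sigma * (r `^ sigma * r `^ e))).
  by rewrite ler_wpM2r ?mulr_ge0 ?powR_ge0// ltW.
have -> : 2 * C * (R0 / r) `^ sigma * (r `^ sigma * r `^ e) = K * r `^ e.
  rewrite mulrA -[_ * _ * r `^ sigma]mulrA -powRM ?divr_ge0 ?ltW//.
  by rewrite divfK ?gt_eqF.
by rewrite mulrC -ler_pdivlMr.
Qed.

Lemma hausdorff_dim_set0 (R : realType) (d : nat) :
  hausdorff_dim (@set0 'rV[R]_d) = 0%E.
Proof.
apply/eqP; rewrite eq_le hausdorff_dim_ge0 andbT; apply: ereal_inf_lbound.
exists 0 => //; split => //; apply: hausdorff_measure_eq0 => delta e d0 e0.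
have := @hausdorff_content_le_cover R d 0 0 delta delta set0 (fun=> set0).
rewrite mul0r => /(_ (lexx _) (ltW d0) (lexx _)) h.
by apply: le_trans (h _ _) _ => [[]//|//|]; rewrite lee_fin ltW.
Qed.

Lemma compact_hausdorff_dim_le_assouad (R : realType) (d : nat)
    (F : set 'rV[R]_d) : compact F -> (hausdorff_dim F <= assouad_dim F)%E.
Proof.
move=> /compact_bounded [M [_ /(_ (`|M| + 1))]].
have -> : M < `|M| + 1 by rewrite (le_lt_trans (ler_norm M))// ltrDl.
move=> /(_ isT) FM.
have [->|/set0P[x Fx]] := eqVneq F set0.
  by rewrite hausdorff_dim_set0 assouad_dim_ge0.
set B := `|M| + 1 in FM; have B0 : 0 < B by rewrite ltr_wpDl.
(* [d.+1] in place of [d] keeps the radius positive for [d = 0]. *)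
apply: (@hausdorff_dim_le_assouad _ _ _ x (d.+1%:R * (2 * B))) => //.
  by rewrite !mulr_gt0.
move=> y Fy; rewrite /eball/=.
have cB z i : F z -> `|z 0 i| <= B.
  by move=> Fz; apply: le_trans (FM _ Fz); exact: coord_le_norm.
apply: (@le_trans _ _ (d%:R * (2 * B))).
  apply: enorm_le_coord => i; rewrite !mxE.
  apply: le_trans (ler_normB _ _) _.
  by have := cB x i Fx; have := cB y i Fy; lra.
by rewrite ler_wpM2r ?mulr_ge0 ?ltW// ltr_nat.
Qed.

(** * The upper bound for the Assouad dimension *)

Definition vcube (R : realType) (d : nat) (v : 'I_d -> 'rV[R]_d)
    (c : 'rV[R]_d) (s : R) : set 'rV[R]_d :=
  [set y | forall i, c 0 i <= frame v y 0 i < c 0 i + s].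

Lemma floor_cell (R : realType) (b : nat) (c s u : R) : (0 < b)%N -> 0 < s ->
  c <= u < c + s ->
  exists j : 'I_b, c + s / b%:R * j%:R <= u < c + s / b%:R * j%:R + s / b%:R.
Proof.
move=> b0 s0 /andP[cu ucs]; have b0' : 0 < b%:R :> R by rewrite ltr0n.
have h0 : 0 < s / b%:R by rewrite divr_gt0.
pose w := (u - c) / (s / b%:R).
have w0 : 0 <= w by rewrite divr_ge0 ?subr_ge0// ltW.
have uw : u = c + s / b%:R * w by rewrite /w mulrC divfK ?gt_eqF// addrC subrK.
have /andP[jw wj] := truncn_itv w0.
have jb : (Num.truncn w < b)%N.
  rewrite -(ltr_nat R) (le_lt_trans jw)// /w ltr_pdivrMr//.
  by rewrite mulrC divfK ?gt_eqF//; lra.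
exists (Ordinal jb) => /=; rewrite {1 2}uw lerD2l ler_pM2l// jw /=.
rewrite -addrA -[X in _ + (_ + X)]mulr1 -mulrDr ltrD2l ltr_pM2l//.
by rewrite natr1.
Qed.

(** Within one residue class a cell is determined by its quotients, which are shifted by 1 to land
    in [box d N]. If these quotients contained a patch of step [m], the points of [F] in its cells
    would follow a patch of scale [s * M * m] up to [s] per coordinate, and
    [d * s <= eps * (s * M * m)]. *)
Lemma res_fiber_patch (R : realType) (k d N M : nat) (eps s : R)
    (v : 'I_d -> 'rV[R]_d) (F : set 'rV[R]_d) (c : 'rV[R]_d)
    (l : {ffun 'I_d -> 'I_M}) (J : {set {ffun 'I_d -> 'I_(M * N)}}) :
  (0 < d)%N -> (1 < k)%N -> (0 < M)%N -> (0 < N)%N -> 0 < s ->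
  orthonormal_vectors v -> d%:R <= eps * M%:R -> ~ contains_AP k eps v F ->
  (forall j, j \in J -> exists2 y, F y &
     vcube v (\row_i (c 0 i + s * (j i)%:R)) s y) ->
  (forall j i, j \in J -> (j i %% M)%N = l i) ->
  (#|J| <= r_ R k d N)%N.
Proof.
move=> d0 k1 M0 N0 s0 vo dM nF FJ Jl.
pose q (j : {ffun 'I_d -> 'I_(M * N)}) : 'rV[nat]_d :=
  \row_i (j i %/ M)%N.+1.
have qI : {in enum J &, injective q}.
  move=> j j'; rewrite !mem_enum => jJ j'J /rowP qq; apply/ffunP => i.
  apply/val_inj; rewrite /= (divn_eq (j i) M) (divn_eq (j' i) M) !Jl//.
  by have := qq i; rewrite !mxE => -[->].
pose S := [fset x in [seq q j | j <- enum J]]%fset.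
have -> : #|J| = #|` S|.
  by rewrite card_fseq undup_id ?map_inj_in_uniq ?enum_uniq// size_map cardE.
apply: card_le_r => //.
  move=> x /=; rewrite !inE => /mapP[j _ ->] i; rewrite mxE /= ltn_divLR//.
  by rewrite -[X in (_ < X)%N]mulnC ltn_ord.
move=> [t [m [m0 tS]]]; apply: nF.
have /choice[y yP] : forall x : {ffun 'I_d -> 'I_k}, exists y, F y /\
    forall i, c 0 i + s * (M%:R * ((t ord0 i)%:R + m%:R * (x i)%:R - 1) + (l
      i)%:R)
      <= frame v y 0 i < c 0 i + s * (M%:R * ((t ord0 i)%:R + m%:R * (x i)%:R
        - 1) + (l i)%:R) + s.
  move=> x; have := tS x; rewrite /= !inE => /mapP[j]; rewrite mem_enum => jJ.
  move=> /rowP tq; have [y Fy yj] := FJ _ jJ; exists y; split=> // i.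
  have := yj i; have := tq i; rewrite !mxE.
  set A := (t _ _ + _)%N => tA.
  have -> : (t ord0 i)%:R + m%:R * (x i)%:R - 1 = (j i %/ M)%N%:R :> R.
    by rewrite -natrM -natrD -/A tA -natr1 addrK.
  suff -> : (j i)%:R = M%:R * (j i %/ M)%N%:R + (l i)%:R :> R by [].
  by rewrite {1}(divn_eq (j i) M) natrD natrM mulrC Jl.
have M0' : 0 < M%:R :> R by rewrite ltr0n.
have m0' : 1 <= m%:R :> R by rewrite ler1n.
have sM0 : 0 < s * M%:R by rewrite mulr_gt0.
apply: (@frame_contains_AP _ _ _ _ (s * M%:R * m%:R) s v F
  (\row_i (c 0 i + s * (M%:R * ((t ord0 i)%:R - 1) + (l i)%:R))) y vo) => //.
- by rewrite mulr_gt0// ltr0n.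
- apply: (@le_trans _ _ (s * (eps * M%:R))); first by rewrite mulrC ler_pM2l.
  have eM0 : 0 <= eps * M%:R by apply: le_trans dM.
  have -> : eps * (s * M%:R * m%:R) = s * (eps * M%:R) * m%:R by ring.
  by rewrite ler_peMr// mulr_ge0// ltW.
- by move=> x; have [] := yP x.
- move=> x i; have [_ /(_ i)] := yP x; rewrite ler_norml => /andP[h1 h2].
  set f := frame v (y x) 0 i in h1 h2 *.
  by rewrite mxE; apply/andP; split; lra.
Qed.

Lemma refine_vcube (R : realType) (k d N M : nat) (eps s : R)
    (v : 'I_d -> 'rV[R]_d) (F : set 'rV[R]_d) (c : 'rV[R]_d) :
  (0 < d)%N -> (1 < k)%N -> (0 < M)%N -> (0 < N)%N -> 0 < s ->
  orthonormal_vectors v -> d%:R <= eps * M%:R -> ~ contains_AP k eps v F ->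
  exists cs : seq 'rV[R]_d, (size cs <= M ^ d * r_ R k d N)%N /\
    forall y, F y -> vcube v c s y ->
      exists2 c', c' \in cs & vcube v c' (s / (M * N)%:R) y.
Proof.
move=> d0 k1 M0 N0 s0 vo dM nF.
have b0 : (0 < M * N)%N by rewrite muln_gt0 M0.
pose h := s / (M * N)%:R.
have h0 : 0 < h by rewrite divr_gt0 ?ltr0n.
pose sub (j : {ffun 'I_d -> 'I_(M * N)}) : 'rV[R]_d :=
  \row_i (c 0 i + h * (j i)%:R).
pose J := [set j | `[< exists2 y, F y & vcube v (sub j) h y >]]%SET.
exists [seq sub j | j <- enum J]; split; last first.
  move=> y Fy yc.
  have /choice[j jP] := fun i => floor_cell b0 s0 (yc i).
  have yj : vcube v (sub [ffun i => j i]) h y.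
    move=> i; have := jP i.
    by have -> : sub [ffun i => j i] 0 i = c 0 i + h * (j i)%:R
      by rewrite mxE ffunE.
  exists (sub [ffun i => j i]) => //; apply/mapP; exists [ffun i => j i] => //.
  by rewrite mem_enum inE; apply/asboolP; exists y.
pose res (j : {ffun 'I_d -> 'I_(M * N)}) : {ffun 'I_d -> 'I_M} :=
  [ffun i => Ordinal (ltn_pmod (j i) M0)].
(* The cells meeting [F] are sorted into [M ^ d] residue classes, each bounded by
   [res_fiber_patch]. *)
rewrite size_map -cardE -sum1_card (partition_big res predT)//=.
apply: (@leq_trans (\sum_(l : {ffun 'I_d -> 'I_M}) r_ R k d N)); last first.
  by rewrite sum_nat_const card_ffun !card_ord.
apply: leq_sum => l _; rewrite sum1dep_card.
apply: (@res_fiber_patch R k d N M eps h v F c l) => //.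
  by move=> j; rewrite !inE => /andP[/asboolP].
by move=> j i; rewrite inE => /andP[_ /eqP <-]; rewrite ffunE.
Qed.

Lemma iter_refine_vcube (R : realType) (k d N M n : nat) (eps s : R)
    (v : 'I_d -> 'rV[R]_d) (F : set 'rV[R]_d) (c : 'rV[R]_d) :
  (0 < d)%N -> (1 < k)%N -> (0 < M)%N -> (0 < N)%N -> 0 < s ->
  orthonormal_vectors v -> d%:R <= eps * M%:R -> ~ contains_AP k eps v F ->
  exists cs : seq 'rV[R]_d, (size cs <= (M ^ d * r_ R k d N) ^ n)%N /\
    forall y, F y -> vcube v c s y ->
      exists2 c', c' \in cs & vcube v c' (s / (M * N)%:R ^+ n) y.
Proof.
move=> d0 k1 M0 N0 s0 vo dM nF; elim: n => [|n [cs [csn csP]]].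
  exists [:: c]; split=> // y Fy yc; exists c; first exact: mem_head.
  by rewrite expr0 divr1.
have sn0 : 0 < s / (M * N)%:R ^+ n.
  by rewrite divr_gt0// exprn_gt0// ltr0n muln_gt0 M0.
have /choice[g gP] := fun c => refine_vcube c d0 k1 M0 N0 sn0 vo dM nF.
exists (flatten [seq g c | c <- cs]); split.
  rewrite size_flatten /shape -map_comp expnS mulnC sumnE big_map.
  apply: (@leq_trans (\sum_(c <- cs) (M ^ d * r_ R k d N))).
    by apply: leq_sum => c' _ /=; have [] := gP c'.
  by rewrite big_const_seq count_predT iter_addn_0 mulnC leq_mul2r csn orbT.
move=> y Fy yc; have [c1 c1cs yc1] := csP _ Fy yc.
have [_ /(_ y Fy yc1)[c2 c2g yc2]] := gP c1.
exists c2; last by move: yc2; rewrite -mulrA -invfM -exprSr.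
by apply/flattenP; exists (g c1) => //; apply: map_f.
Qed.

(** Write [b = M * N] and [q = M ^ d * r(N)]. A ball of radius [R0] fits into a cube of side
    [3 * R0]. Refining [n + 1] times, with [n + 1] least such that [b ^ (n + 1) >= K = 3 d R0 / r],
    brings the diameters down to [r]; the number of cells is at most
    [q ^ (n + 1) = q * (b ^ n) ^ sigma], which is at most [q * K ^ sigma]. *)
Lemma assouad_dim_le (R : realType) (k d N M : nat) (eps sigma : R)
    (v : 'I_d -> 'rV[R]_d) (F : set 'rV[R]_d) :
  (0 < d)%N -> (1 < k)%N -> (1 < M)%N -> (0 < N)%N ->
  orthonormal_vectors v -> d%:R <= eps * M%:R -> ~ contains_AP k eps v F ->
  0 <= sigma -> (M * N)%:R `^ sigma = (M ^ d * r_ R k d N)%:R ->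
  (assouad_dim F <= sigma%:E)%E.
Proof.
move=> d0 k1 M1 N0 vo dM nF sigma0 sigmaE; have M0 := ltnW M1.
set b := (M * N)%N in sigmaE *; set q := (M ^ d * _)%N in sigmaE *.
have b1 : (1 < b)%N by rewrite /b (leq_trans M1)// leq_pmulr.
have b0 : 0 < b%:R :> R by rewrite ltr0n ltnW.
apply: ereal_inf_lbound; exists sigma => //; split => //.
(* The factor [q] pays for the last refinement, which may overshoot [K]. *)
exists (q%:R * (3 * d%:R) `^ sigma).
  by rewrite -sigmaE mulr_gt0// powR_gt0// mulr_gt0// ltr0n.
move=> r R0 r0 rR0 x Fx.
pose K := 3 * d%:R * (R0 / r).
have R00 : 0 < R0 by apply: lt_trans rR0.
have K1 : 1 < K.
  rewrite /K -[ltLHS]mulr1 ltr_pM//; first by rewrite -natrM ltr1n; lia.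
  by rewrite ltr_pdivlMr// mul1r.
have [n0 Kn0] : exists n, K <= b%:R ^+ n.
  exists (Num.truncn K).+1; apply: ltW;
    apply: (@lt_le_trans _ _ (Num.truncn K).+1%:R).
    exact: truncnS_gt.
  by rewrite -natrX ler_nat ltnW// ltn_expl.
have exn : exists n, K <= b%:R ^+ n by exists n0.
case: (ex_minnP exn) => -[|n] Kn nmin.
  by move: Kn; rewrite expr0 leNgt K1.
have bnK : b%:R ^+ n < K.
  by rewrite ltNge; apply/negP => /nmin; rewrite ltnn.
have K0 : 0 < 3 * R0 by rewrite mulr_gt0.
(* The ball spans [2 * R0] in each frame coordinate; the side [3 * R0] leaves room at the open end
   of the cube. *)
pose c : 'rV[R]_d := frame v x - const_mx R0.
have [cs [csn csP]] := @iter_refine_vcube R k d N M n.+1 eps (3 * R0) v F c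
  d0 k1 M0 N0 K0 vo dM nF.
rewrite -/b -/q in csn csP.
apply: (@le_trans _ _ (size cs)%:R%:E).
  apply: ereal_inf_lbound; exists (size cs) => //=.
  exists (fun i : 'I_(size cs) => vcube v (nth 0 cs i) (3 * R0 / b%:R ^+
    n.+1)); split.
    move=> i; apply: diam_le; first exact: ltW.
    move=> y z yc zc; rewrite -(enorm_frame _ vo).
    apply: (@le_trans _ _ (d%:R * (3 * R0 / b%:R ^+ n.+1))).
      apply: enorm_le_coord => j; rewrite frameB_coord.
      have /andP[h1 h2] := yc j; have /andP[h3 h4] := zc j.
      by rewrite ler_norml; apply/andP; split; lra.
    rewrite mulrA ler_pdivrMr ?exprn_gt0// -ler_pdivrMl//.
    by apply: le_trans Kn; rewrite /K le_eqVlt; apply/orP; left; apply/eqP;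
      field; rewrite gt_eqF.
  move=> y [yx Fy].
  have [|c' c'cs yc'] := csP y Fy.
    move=> i; have -> : c 0 i = frame v x 0 i - R0 by rewrite /c !mxE.
    have : `|frame v (y - x) 0 i| <= R0.
      by apply: le_trans yx; rewrite -(enorm_frame _ vo); exact: coord_le_enorm.
    rewrite frameB_coord ler_norml => /andP[h1 h2].
    by apply/andP; split; lra.
  move/(nthP 0) : c'cs => [i ics cE]; exists (Ordinal ics) => //=.
  by rewrite cE.
rewrite lee_fin; apply: (@le_trans _ _ (q ^ n.+1)%:R); first by rewrite ler_nat.
have K30 : 0 <= 3 * d%:R :> R by [].
rewrite expnS natrM -mulrA ler_wpM2l// -powRM ?divr_ge0 ?(ltW r0) ?(ltW R00)//.
rewrite natrX -sigmaE -powR_mulrn ?powR_ge0// powRAC powR_mulrn// ?ler0n//.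
by rewrite ge0_ler_powR// ?nnegrE ?exprn_ge0 ?(ltW b0) ?(ltW bnK)// (ltW
  (lt_trans _ K1)).
Qed.

(** * Self-similar digit sets *)

Definition digit_map (R : realType) (d : nat) (L : R) (a : 'rV[nat]_d)
    (x : 'rV[R]_d) : 'rV[R]_d := L^-1 *: (embed R a + x).

Definition cube (R : realType) (d : nat) (rho : R) : set 'rV[R]_d :=
  [set x | forall i, 0 <= x 0 i <= rho].
Arguments cube {R} d rho.

(** The [n]-th iterated image of the cube under the digit maps, written by expanding the point
    rather than contracting the set, so that closedness passes through preimages. *)
Fixpoint digit_level (R : realType) (d : nat) (L rho : R)
    (A : set 'rV[nat]_d) (n : nat) : set 'rV[R]_d :=
  if n is n.+1 then
    [set x | exists2 a, A a & digit_level L rho A n (L *: x - embed R a)]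
  else cube d rho.

(* The set of sums [a_1 / L + a_2 / L^2 + ...] with digits [a_j] in [A]. *)
Definition digit_set (R : realType) (d : nat) (L rho : R)
    (A : set 'rV[nat]_d) : set 'rV[R]_d :=
  \bigcap_n digit_level L rho A n.

(** [ds_rhoL] makes every digit map send [cube d rho] into itself, and [ds_rho1] makes the images
    for distinct digits disjoint. *)
Record digit_system (R : realType) (d N : nat) (L rho : R)
    (A : set 'rV[nat]_d) : Prop := DigitSystem {
  ds_L : 1 < L;
  ds_rho0 : 0 < rho;
  ds_rho1 : rho < 1;
  ds_rhoL : N%:R + rho <= L * rho;
  ds_box : A `<=` box d N;
  ds_ex : A !=set0 }.

Lemma digit_mapK (R : realType) (d : nat) (L : R) (a : 'rV[nat]_d)
    (x : 'rV[R]_d) : L != 0 -> L *: digit_map L a x - embed R a = x.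
Proof.
by move=> L0; rewrite /digit_map scalerA divff// scale1r addrC addKr.
Qed.

Lemma digit_mapVK (R : realType) (d : nat) (L : R) (a : 'rV[nat]_d)
    (x : 'rV[R]_d) : L != 0 -> digit_map L a (L *: x - embed R a) = x.
Proof.
by move=> L0; rewrite /digit_map addrC subrK scalerA mulVf// scale1r.
Qed.

Lemma contracting_digit_map (R : realType) (d : nat) (L : R)
    (a : 'rV[nat]_d) : 1 < L -> contracting_similarity (digit_map L a).
Proof.
move=> L1; have L0 : 0 < L by apply: lt_trans L1.
exists L^-1; split; [by rewrite invr_gt0|by rewrite invf_lt1|].
move=> x y; rewrite /digit_map -scalerBr enormZ ger0_norm ?invr_ge0 ?ltW//.
by rewrite opprD addrACA subrr add0r.
Qed.

Lemma cube_digit_unique (R : realType) (d : nat) (rho : R) (a b : 'rV[nat]_d)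
    (x : 'rV[R]_d) : rho < 1 ->
  cube d rho (x - embed R a) -> cube d rho (x - embed R b) -> a = b.
Proof.
move=> rho1 xa xb; apply/rowP => i; apply: (@natr_eq_of_dist_lt1 R).
have := xa i; have := xb i; rewrite !mxE => /andP[h1 h2] /andP[h3 h4].
by rewrite ltr_norml; apply/andP; split; lra.
Qed.

Lemma digit_levelS (R : realType) (d N : nat) (L rho : R)
    (A : set 'rV[nat]_d) (n : nat) : digit_system N L rho A ->
  digit_level L rho A n.+1 `<=` digit_level L rho A n.
Proof.
move=> [L1 rho0 rho1 rhoL AN _]; elim: n => [|n IH] x; last first.
  by move=> [a Aa /IH xa]; exists a.
move=> [a Aa xa] i; have := xa i; have /andP[a1 aN] := AN _ Aa i.
rewrite !mxE => /andP[h1 h2].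
have h3 : 0 <= (a 0 i)%:R :> R by [].
have h4 : (a 0 i)%:R <= N%:R :> R by rewrite ler_nat.
have L0 : 0 < L by apply: lt_trans L1.
rewrite -(@ler_pM2l _ L L0 0) -(@ler_pM2l _ L L0 _ rho) mulr0.
by apply/andP; split; lra.
Qed.

Lemma digit_set_sub_cube (R : realType) (d : nat) (L rho : R)
    (A : set 'rV[nat]_d) : digit_set L rho A `<=` cube d rho.
Proof. by move=> x /(_ 0%N I). Qed.

Lemma digit_level_sub_cube (R : realType) (d N : nat) (L rho : R)
    (A : set 'rV[nat]_d) (n : nat) : digit_system N L rho A ->
  digit_level L rho A n `<=` cube d rho.
Proof. by move=> AL; elim: n => // n IH x /(digit_levelS AL) /IH. Qed.

Lemma digit_set_map (R : realType) (d N : nat) (L rho : R)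
    (A : set 'rV[nat]_d) a x : digit_system N L rho A -> A a ->
  digit_set L rho A x -> digit_set L rho A (digit_map L a x).
Proof.
move=> AL Aa Fx n _; apply: (digit_levelS AL); exists a => //.
rewrite digit_mapK; first exact: Fx.
by rewrite gt_eqF// (lt_trans _ (ds_L AL)).
Qed.

(** Each level provides a first digit of [x]; these all agree because the cubes at distinct digits
    are disjoint. *)
Lemma digit_set_expand (R : realType) (d N : nat) (L rho : R)
    (A : set 'rV[nat]_d) x : digit_system N L rho A ->
  digit_set L rho A x ->
  exists2 a, A a & digit_set L rho A (L *: x - embed R a).
Proof.
move=> AL Fx; have [a Aa xa] := Fx 1%N I; exists a => // n _.
have [b Ab xb] := Fx n.+1 I.
rewrite (_ : a = b)//; apply: (cube_digit_unique (ds_rho1 AL) xa).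
exact: (digit_level_sub_cube AL) xb.
Qed.

Lemma digit_set_nonempty (R : realType) (d N : nat) (L rho : R)
    (A : set 'rV[nat]_d) : digit_system N L rho A -> digit_set L rho A !=set0.
Proof.
move=> [L1 rho0 rho1 rhoL AN [a Aa]].
have L10 : 0 < L - 1 by rewrite subr_gt0.
(* The fixed point of the digit map of [a]. *)
exists ((L - 1)^-1 *: embed R a) => n _; elim: n => [|n IH].
  move=> i; have /andP[a1 aN] := AN _ Aa i.
  rewrite !mxE mulr_ge0 ?invr_ge0 ?(ltW L10)//= mulrC ler_pdivrMr//.
  have : (a 0 i)%:R <= N%:R :> R by rewrite ler_nat.
  by rewrite mulrBr mulr1 [rho * L]mulrC; lra.
exists a => //; rewrite (_ : _ - _ = (L - 1)^-1 *: embed R a)//.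
apply/rowP => i; rewrite !mxE; field.
by rewrite gt_eqF.
Qed.

Lemma closed_cube (R : realType) (d : nat) (rho : R) : closed (cube d rho).
Proof.
rewrite (_ : cube d rho =
  \bigcap_(i in [set: 'I_d]) [set x | x 0 i \in `[0, rho]]); last first.
  by apply/seteqP; split=> [x xc i _ |x xc i]; [exact: xc|exact: (xc i I)].
apply: closed_bigI => i _.
apply: (@preimage_closed _ _ (fun x : 'rV[R]_d => x 0 i) `[0, rho]%classic).
  by move=> x _; exact: coord_continuous.
exact: interval_closed.
Qed.

Lemma continuous_affine (R : realType) (d : nat) (L : R) (p : 'rV[R]_d) :
  continuous (fun x : 'rV[R]_d => L *: x - p).
Proof.
move=> x; apply: (@cvgB R 'rV[R]_d _ (nbhs x) _ (fun x => L *: x) (fun=> p)).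
  exact: scaler_continuous.
exact: cvg_cst.
Qed.

Lemma finite_digits (d N : nat) (A : set 'rV[nat]_d) :
  A `<=` box d N -> finite_set A.
Proof. by move=> AN; apply: sub_finite_set AN (finite_box d N). Qed.

Lemma closed_digit_level (R : realType) (d N : nat) (L rho : R)
    (A : set 'rV[nat]_d) (n : nat) : digit_system N L rho A ->
  closed (digit_level L rho A n).
Proof.
move=> AL; elim: n => [|n IH]; first exact: closed_cube.
rewrite (_ : digit_level _ _ _ _ = \bigcup_(a in A)
    ((fun x => L *: x - embed R a) @^-1` digit_level L rho A n)); last first.
  by apply/seteqP; split=> x [a Aa xa]; exists a.
apply: closed_bigcup; first exact: finite_digits (ds_box AL).
move=> a Aa; apply: preimage_closed => // x _; exact: continuous_affine.
Qed.

Lemma closed_digit_set (R : realType) (d N : nat) (L rho : R)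
    (A : set 'rV[nat]_d) : digit_system N L rho A ->
  closed (digit_set L rho A).
Proof. by move=> AL; apply: closed_bigI => n _;
  exact: closed_digit_level AL. Qed.

Lemma bounded_coord (R : realType) (d : nat) (A : set 'rV[R]_d) (B : R) :
  0 <= B -> (forall x, A x -> forall i, `|x 0 i| <= B) -> bounded_set A.
Proof.
move=> B0 AB; exists B; split; first exact: num_real.
move=> M BM x Ax; apply: norm_le_coord; first exact: le_trans (ltW BM).
by move=> i; apply: le_trans (ltW BM); exact: AB.
Qed.

Lemma compact_digit_set (R : realType) (d N : nat) (L rho : R)
    (A : set 'rV[nat]_d) : digit_system N L rho A ->
  compact (digit_set L rho A).
Proof.
move=> AL; apply: bounded_closed_compact; last exact: closed_digit_set AL.
apply: (@bounded_coord _ _ _ rho); first exact: ltW (ds_rho0 AL).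
move=> x /digit_set_sub_cube xc i; have /andP[h1 h2] := xc i.
by rewrite ger0_norm.
Qed.

Lemma open_unit_cube (R : realType) (d : nat) :
  open [set x : 'rV[R]_d | forall i, x 0 i \in `]0, 1[].
Proof.
rewrite openE => x xV; rewrite /interior/=.
apply: (@filter_forall _ _ (fun i =>
  [set y : 'rV[R]_d | y 0 i \in `]0, 1[]) (nbhs x)) => i.
have : open ((fun y : 'rV[R]_d => y 0 i) @^-1` `]0, 1[%classic).
  by apply: open_comp; [move=> y _;
    exact: coord_continuous|exact: interval_open].
by rewrite openE => /(_ x (xV i)).
Qed.

Lemma digit_set_self_similar (R : realType) (d N : nat) (L rho : R)
    (S : {fset 'rV[nat]_d}) : digit_system N L rho [set` S] ->
  self_similar_osc (digit_set L rho [set` S]).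
Proof.
move=> AL; have L0 : 0 < L by apply: lt_trans (ds_L AL).
(* This follows from [N <= (L - 1) * rho] and [rho < 1], and keeps the images of the open unit cube
   inside it. *)
have NL : N%:R + 1 <= L.
  have := ds_rhoL AL; have := ds_rho0 AL; have := ds_rho1 AL; have := ds_L AL.
  move=> h1 h2 h3 h4; have : (L - 1) * rho <= (L - 1) * 1 by rewrite ler_pM2l;
    lra.
  by lra.
pose f (i : 'I_#|` S|) := @digit_map R d L (nth 0 (enum_fset S) i).
have fS (i : 'I_#|` S|) : [set` S] (nth 0 (enum_fset S) i) by apply: mem_nth.
exists #|` S|, f; split.
- by move=> i; exact: contracting_digit_map (ds_L AL).
- exists [set x : 'rV[R]_d | forall i, x 0 i \in `]0, 1[]; split.
  + exists (const_mx 2^-1) => i; rewrite mxE in_itv/=.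
    by apply/andP; split; lra.
  + apply: (@bounded_coord _ _ _ 1) => // x xV i.
    by have := xV i; rewrite in_itv/= => /andP[h1 h2]; rewrite ger0_norm ltW.
  + exact: open_unit_cube.
  + move=> _ [i _ [x xV <-]] j; have := xV j; rewrite in_itv/= => /andP[h1 h2].
    have /andP[a1 aN] := ds_box AL (fS i) j.
    rewrite in_itv/= !mxE; set a := nth _ _ _ in a1 aN *.
    have h3 : 0 <= (a 0 j)%:R :> R by [].
    have h4 : (a 0 j)%:R <= N%:R :> R by rewrite ler_nat.
    rewrite mulr_gt0 ?invr_gt0//=; last by lra.
    by rewrite mulrC ltr_pdivrMr// mul1r; lra.
  + move=> i j ij; apply/seteqP; split=> // _ [[x xV <-] [y yV]].
    move=> /(congr1 (fun z => L *: z));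
      rewrite /f /digit_map !scalerA divff ?gt_eqF// !scale1r.
    move=> xy; suff : nth 0 (enum_fset S) i = nth 0 (enum_fset S) j.
      by move=> /eqP; rewrite nth_uniq ?fset_uniq// => /eqP/val_inj/eqP;
        apply/negP.
    apply/rowP => l; apply: (@natr_eq_of_dist_lt1 R).
    have := xV l; have := yV l; rewrite !in_itv/= => /andP[h1 h2] /andP[h3 h4].
    move/rowP: xy => /(_ l); rewrite !mxE => xy.
    by rewrite ltr_norml; apply/andP; split; lra.
- split; [exact: digit_set_nonempty AL|exact: compact_digit_set AL|].
  apply/seteqP; split=> [x /(digit_set_expand AL)[a aS xa]|_ [i _ [x Fx <-]]].
    have ia : (index a (enum_fset S) < #|` S|)%N by rewrite index_mem.
    exists (Ordinal ia) => //; exists (L *: x - embed R a) => //.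
    by rewrite /f/= nth_index// digit_mapVK// gt_eqF.
  exact: digit_set_map AL (fS i) Fx.
Qed.

(** Expanding by [L] an approximate patch of scale [Delta] and subtracting first digits leaves tails
    in [cube d rho], so the first digits are within [2 * rho] of a patch and round to a lattice
    patch of step [b]. If [b > 0] this patch lies in [A]. If [b = 0] all first digits agree, and the
    tails form an approximate patch in the digit set of scale [L * Delta] with the same relative
    error. The scale cannot grow forever in a bounded set. *)
Lemma digit_set_no_AP (R : realType) (d k N : nat) (L rho : R)
    (A : set 'rV[nat]_d) : (0 < d)%N -> (1 < k)%N ->
  digit_system N L rho A -> 8 * k.+1%:R * rho <= 1 -> 2 <= L ->
  ~ lattice_patch k A ->
  ~ contains_AP k (8 * L)^-1 (@std_basis R d) (digit_set L rho A).
Proof.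
move=> d0 k1 AL krho L2 nA; set F := digit_set L rho A.
have L0 : 0 < L by apply: lt_trans (ds_L AL).
have k0 : 0 < k.+1%:R :> R by [].
have rho0 := ds_rho0 AL.
have k3 : 3 <= k.+1%:R :> R by rewrite ler_nat.
(* Twice the tolerance of the statement, since the infimum in [is_AP] need not be attained. *)
pose e : R := (4 * L)^-1.
have eL : e * L = 4^-1 by rewrite /e; field; rewrite gt_eqF.
have e0 : 0 < e by rewrite invr_gt0 mulr_gt0.
have e8 : e <= 8^-1 by rewrite lef_pV2 ?posrE ?mulr_gt0//; lra.
pose config Delta (T : 'rV[R]_d) (y : {ffun 'I_d -> 'I_k} -> 'rV[R]_d) :=
  [/\ 0 < Delta, forall x, F (y x) &
    forall x i, `|y x 0 i - (T 0 i + Delta * (x i)%:R)| <= e * Delta].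
(* Neighbouring points differ by at least [Delta - 2 * e * Delta] in some coordinate, while the
   whole set has width [rho]. *)
have small Delta T y : config Delta T y -> Delta <= 2 * rho.
  move=> [D0 Fy yT]; pose i0 := Ordinal d0.
  pose x0 : {ffun 'I_d -> 'I_k} := [ffun=> Ordinal (ltnW k1)].
  pose x1 : {ffun 'I_d -> 'I_k} := [ffun=> Ordinal k1].
  have := yT x0 i0; have := yT x1 i0.
  rewrite !ffunE /= !ler_norml => /andP[h1 h2] /andP[h3 h4].
  have /digit_set_sub_cube/(_ i0)/andP[h5 h6] := Fy x0.
  have /digit_set_sub_cube/(_ i0)/andP[h7 h8] := Fy x1.
  have : e * Delta <= 8^-1 * Delta by rewrite ler_pM2r.
  by lra.
have rho8 : 24 * rho <= 1.
  apply: le_trans krho; rewrite ler_pM2r//; lra.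
(* Induction on the number of expansions that raise the scale to 1, which exceeds [2 * rho]. *)
have noconfig n : forall Delta T y, config Delta T y -> 1 <=
  Delta * L ^+ n -> False.
  elim: n => [|n IH] Delta T y C DL.
    by have := small _ _ _ C; move: DL; rewrite expr0; lra.
  have D2 := small _ _ _ C; have [D0 Fy yT] := C.
  have /choice[a aP] : forall x, exists a, A a /\ F (L *: y x - embed R a).
    by move=> x; have [a Aa ya] := digit_set_expand AL (Fy x); exists a.
  have LyT x i : `|L * y x 0 i - (L * T 0 i + L * Delta * (x i)%:R)| <=
    e * (L * Delta).
    have -> : L * y x 0 i - (L * T 0 i + L * Delta * (x i)%:R) =
      L * (y x 0 i - (T 0 i + Delta * (x i)%:R)) by ring.
    by rewrite normrM (gtr0_norm L0) mulrCA ler_pM2l.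
  have [||t [b [_ ta]]] := @round_patch R d k (L * Delta) (2 * rho) (L *: T) a
    d0 k1 (mulr_gt0 L0 D0).
  - by lra.
  - move=> x i; have := LyT x i.
    have /digit_set_sub_cube/(_ i) := (aP x).2; rewrite !mxE => /andP[h1 h2].
    rewrite mulrA eL !ler_norml => /andP[h3 h4].
    by apply/andP; split; lra.
  case: b ta => [|b] ta; last first.
    apply: nA; exists t, b.+1; split=> // x; rewrite -ta; exact: (aP x).1.
  apply: (IH (L * Delta) (L *: T - embed R t) (fun x => L *: y x - embed R t)).
    split; first by rewrite mulr_gt0.
      move=> x; have := (aP x).2; rewrite ta (_ : (\row_i _)%N = t)//.
      by apply/rowP => i; rewrite mxE mul0n addn0.
    move=> x i; have := LyT x i; rewrite !mxE.
    by rewrite (_ : L * y x 0 i - (t 0 i)%:R - (L * T 0 i - (t 0 i)%:R + L *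
      Delta * (x i)%:R) =
      L * y x 0 i - (L * T 0 i + L * Delta * (x i)%:R))//; ring.
  by rewrite [L * Delta]mulrC -mulrA -exprS.
move=> /contains_AP_approx[Delta [T [D0 /(_ e)]]].
have -> : (8 * L)^-1 < e by rewrite ltf_pV2 ?posrE ?mulr_gt0// ltr_pM2r//; lra.
move=> /(_ isT)[y [Fy yT]].
apply: (noconfig (Num.truncn Delta^-1).+1 Delta T y); first by split.
rewrite mulrC -ler_pdivrMr// mul1r.
apply: le_trans (ltW (truncnS_gt Delta^-1)) _.
apply: (@le_trans _ _ (2 ^+ (Num.truncn Delta^-1).+1)).
  by rewrite -natrX ler_nat ltnW// ltn_expl.
by rewrite lerXn2r ?nnegrE// ltW.
Qed.

(** * The Hausdorff dimension of digit sets *)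

(** A cylinder: for [p = L ^ (n - 1) a_1 + ... + a_n] with digits in [A], the points of the digit
    set whose first [n] digits are these. *)
Definition piece (R : realType) (d : nat) (L rho : R) (A : set 'rV[nat]_d)
    (n : nat) (p : 'rV[R]_d) : set 'rV[R]_d :=
  [set x | digit_set L rho A (L ^+ n *: x - p)].

Lemma piece_child (R : realType) (d N : nat) (L rho : R)
    (A : set 'rV[nat]_d) (n : nat) (p : 'rV[R]_d) a :
  digit_system N L rho A -> A a ->
  piece L rho A n.+1 (L *: p + embed R a) `<=` piece L rho A n p.
Proof.
move=> AL Aa x /(digit_set_map AL Aa); have L0 := lt_trans ltr01 (ds_L AL).
rewrite /piece/= exprS -scalerA opprD addrA -scalerBr digit_mapVK//.
by rewrite gt_eqF.
Qed.

(** Distinct digits differ by at least 1 in some coordinate, and the tails change this by at most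
    [rho]. *)
Lemma piece_separated (R : realType) (d N : nat) (L rho : R)
    (A : set 'rV[nat]_d) (n : nat) (p : 'rV[R]_d) a b x y :
  digit_system N L rho A -> a != b ->
  piece L rho A n.+1 (L *: p + embed R a) x ->
  piece L rho A n.+1 (L *: p + embed R b) y ->
  (1 - rho) / L ^+ n.+1 <= enorm (x - y).
Proof.
move=> AL ab /digit_set_sub_cube xa /digit_set_sub_cube yb.
have L0 := lt_trans ltr01 (ds_L AL).
have [i abi] : exists i, a 0 i != b 0 i.
  apply: contrapT => nab; move/eqP: ab; apply; apply/rowP => i.
  by apply: contrapT => /eqP abi; apply: nab; exists i.
apply: le_trans (coord_le_enorm _ i); rewrite ler_pdivrMr ?exprn_gt0//.
rewrite -[X in _ * X](gtr0_norm (exprn_gt0 n.+1 L0)) -normrM !mxE.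
have := xa i; have := yb i; rewrite !mxE => /andP[h1 h2] /andP[h3 h4].
have : (1 <= (a 0 i)%:R - (b 0 i)%:R :> R) || (1 <=
  - ((a 0 i)%:R - (b 0 i)%:R) :> R).
  by rewrite -ler_normr leNgt; apply/negP => /natr_eq_of_dist_lt1; exact/eqP.
by case/orP => h5; rewrite ler_normr; apply/orP; [left|right]; lra.
Qed.

Lemma closed_piece (R : realType) (d N : nat) (L rho : R)
    (A : set 'rV[nat]_d) (n : nat) (p : 'rV[R]_d) :
  digit_system N L rho A -> closed (piece L rho A n p).
Proof.
move=> AL.
rewrite (_ : piece _ _ _ _ _ = (fun x =>
  L ^+ n *: x - p) @^-1` digit_set L rho A)//.
apply: preimage_closed.
  by move=> x _; exact: continuous_affine.
exact: closed_digit_set AL.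
Qed.

Lemma piece_nonempty (R : realType) (d N : nat) (L rho : R)
    (A : set 'rV[nat]_d) (n : nat) (p : 'rV[R]_d) :
  digit_system N L rho A -> piece L rho A n p !=set0.
Proof.
move=> AL; have L0 := lt_trans ltr01 (ds_L AL).
have [x Fx] := digit_set_nonempty AL; exists ((L ^+ n)^-1 *: (x + p)).
by rewrite /piece/= scalerA divff ?expf_neq0 ?gt_eqF// scale1r addrK.
Qed.

(** The weight of the part of a cover that meets [E]. Following it down nested pieces takes the
    place of a mass distribution on the digit set. *)
Definition hit_sum (R : realType) (d : nat) (U : nat -> set 'rV[R]_d)
    (g : nat -> \bar R) (E : set 'rV[R]_d) : \bar R :=
  (\sum_(0 <= i <oo) if `[< U i `&` E !=set0 >] then g i else 0)%E.

Lemma hit_sum_le (R : realType) (d : nat) (U : nat -> set 'rV[R]_d)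
    (g : nat -> \bar R) (E : set 'rV[R]_d) : (forall i, 0 <= g i)%E ->
  (hit_sum U g E <= \sum_(0 <= i <oo) g i)%E.
Proof.
move=> g0; apply: lee_nneseries => i _; first by case: ifP.
by case: ifP.
Qed.

Lemma le_hit_sum (R : realType) (d : nat) (U : nat -> set 'rV[R]_d)
    (g : nat -> \bar R) (E : set 'rV[R]_d) i : (forall i, 0 <= g i)%E ->
  U i `&` E !=set0 -> (g i <= hit_sum U g E)%E.
Proof.
move=> g0 UE; rewrite /hit_sum (nneseriesD1 (n := i))//; last by move=> j _;
  case: ifP.
rewrite asboolT//; apply: leeDl; apply: nneseries_ge0 => j _ _; by case: ifP.
Qed.

(* Pigeonhole: a set meeting two children has gauge too large for it to hit
   the piece at all, so the hit sums of the children add up to at most that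
   of the piece. *)
Lemma light_child (R : realType) (d N : nat) (L rho c : R)
    (S : {fset 'rV[nat]_d}) (U : nat -> set 'rV[R]_d) (g : nat -> \bar R)
    (n : nat) (p : 'rV[R]_d) :
  digit_system N L rho [set` S] -> (forall i, 0 <= g i)%E ->
  (forall i x y, U i x -> U i y -> (1 - rho) / L ^+ n.+1 <= enorm (x - y) ->
     ((c / #|` S|%:R ^+ n)%:E <= g i)%E) ->
  (hit_sum U g (piece L rho [set` S] n p) < (c / #|` S|%:R ^+ n)%:E)%E ->
  exists2 a, a \in S &
    (hit_sum U g (piece L rho [set` S] n.+1 (L *: p + embed R a))
       < (c / #|` S|%:R ^+ n.+1)%:E)%E.
Proof.
move=> AL g0 gU light; set m := #|` S| in gU light *.
have m0 : 0 < m%:R :> R.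
  have [a aS] := ds_ex AL; rewrite ltr0n cardfs_gt0.
  by apply/fset0Pn; exists a.
apply: contrapT => heavy; move: light; apply/negP; rewrite -leNgt.
pose child a := piece L rho [set` S] n.+1 (L *: p + embed R a).
have {}heavy a : a \in S -> ((c / m%:R ^+ n.+1)%:E <= hit_sum U g (child a))%E.
  by move=> aS; rewrite leNgt; apply/negP => h; apply: heavy; exists a.
rewrite leNgt; apply/negP => light.
have : ((c / m%:R ^+ n)%:E <= \sum_(a <- enum_fset S) hit_sum U g (child a))%E.
  apply: (@le_trans _ _ (\sum_(a <- enum_fset S) (c / m%:R ^+ n.+1)%:E)%E).
    rewrite sumEFin big_const_seq count_predT iter_addr_0 lee_fin -[X in _ *+
      X]/m.
    rewrite -[leRHS]mulr_natr exprSr invfM mulrA divfK// gt_eqF//.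
  by rewrite big_seq [leRHS]big_seq; apply: lee_sum => a; exact: heavy.
apply/negP; rewrite -ltNge; apply: (le_lt_trans _ light).
rewrite /hit_sum -nneseries_sum; last by move=> a j _; case: ifP.
apply: lee_nneseries => [i _|i _]; first by rewrite sume_ge0// => a; case: ifP.
have [[a aS Ua]|nohit] := pselect (exists2 a, a \in S & U i `&` child a !=set0).
  rewrite (bigD1_seq a)//= big1_seq ?addr0.
    rewrite !asboolT//; have [x [Ux xa]] := Ua; exists x; split=> //.
    exact: (piece_child AL aS xa).
  move=> b /andP[ba bS]; rewrite asboolF// => -[y [Uy yb]].
  have [x [Ux xa]] := Ua; have xp := piece_child AL aS xa.
  have gi := gU i x y Ux Uy (piece_separated AL _ xa yb).
  have : (g i < (c / m%:R ^+ n)%:E)%E.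
    by apply: (le_lt_trans _ light); apply: le_hit_sum => //; exists x.
  by apply/negP; rewrite -leNgt; apply: gi; rewrite eq_sym.
rewrite big1_seq; first by case: ifP.
by move=> a /andP[_ aS]; rewrite asboolF// => Ua; apply: nohit; exists a.
Qed.

(** If the measure vanished, some cover would have total weight below [c]. By [light_child] one
    descends through nested pieces of level [n] whose hit sums stay below [c / m ^ n], where [m] is
    the number of digits. A point common to all of them lies in some [U i], whose weight is then
    below every [c / m ^ n] although it is positive. *)
Lemma hausdorff_measure_digit_set (R : realType) (d N : nat) (L rho s : R)
    (S : {fset 'rV[nat]_d}) :
  digit_system N L rho [set` S] -> (1 < #|` S|)%N -> 0 <= s ->
  L `^ s <= #|` S|%:R ->
  hausdorff_measure s (digit_set L rho [set` S]) != 0%E.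
Proof.
move=> AL S1 s0 Ls; have L0 := lt_trans ltr01 (ds_L AL).
set m := #|` S| in S1 Ls *; set F := digit_set L rho [set` S].
have m0 : 0 < m%:R :> R by rewrite ltr0n ltnW.
have rho1 : 0 < 1 - rho by rewrite subr_gt0 (ds_rho1 AL).
(* A set of diameter at least [(1 - rho) / L ^ (n + 1)] has gauge at least
   [(1 - rho) ^ s / m ^ (n + 1)], since [L ^ s <= m]; this is [c / m ^ n]. *)
pose c := (1 - rho) `^ s / m%:R; have c0 : 0 < c by rewrite divr_gt0// powR_gt0.
apply/negP => /eqP F0.
have : (hausdorff_content s 1 F < (c / 2)%:E)%E.
  apply: (@le_lt_trans _ _ 0%E); last by rewrite lte_fin divr_gt0.
  by rewrite -F0; apply: ereal_sup_ubound; exists 1 => //=; exact: ltr01.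
move=> /ereal_inf_lt[_ [U [_ FU] <-] Uc].
(* The added terms sum to at most [c / 2] and give every [U i] positive weight, even one of diameter
   0. *)
pose g i := (hgauge s (U i) + ((c / 2) / (2 ^ i.+1)%N%:R)%:E)%E.
have e0 i : 0 < (c / 2) / (2 ^ i.+1)%N%:R :> R.
  by apply: divr_gt0; [exact: divr_gt0|rewrite ltr0n expn_gt0].
have g0 i : (0 < g i)%E.
  by apply: (lt_le_trans (_ : (0 < _)%E) (leeDr _ (hgauge_ge0 s (U i))));
    rewrite lte_fin.
have g0' i : (0 <= g i)%E := ltW (g0 i).
have gc : (\sum_(0 <= i <oo) g i < c%:E)%E.
  apply: le_lt_trans (epsilon_trick _ _ _) _.
  - by move=> i; exact: hgauge_ge0.
  - by rewrite ltW// divr_gt0.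
  - by rewrite [c in ltRHS](splitr c) EFinD lteD2rE.
have gU n i x y : U i x -> U i y -> (1 - rho) / L ^+ n.+1 <= enorm (x - y) ->
    ((c / m%:R ^+ n)%:E <= g i)%E.
  move=> Ux Uy xy; apply: (@le_trans _ _ (hgauge s (U i))); last first.
    by rewrite leeDl// lee_fin ltW.
  have r0 : 0 <= (1 - rho) / L ^+ n.+1 by apply: divr_ge0;
    [exact: ltW|apply: exprn_ge0; exact: ltW].
  apply: le_trans (hgauge_ge s0 r0 Ux Uy xy); rewrite lee_fin.
  rewrite powRM ?invr_ge0 ?exprn_ge0 ?(ltW L0) ?(ltW rho1)//.
  rewrite /c -mulrA -invfM -exprS ler_wpM2l ?powR_ge0//.
  rewrite -powR_inv1 ?exprn_ge0 ?(ltW L0)// -powRrM mulrC powRrM powR_inv1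
    ?powR_ge0//.
  rewrite lef_pV2 ?posrE ?exprn_gt0 ?powR_gt0 ?exprn_gt0//.
  rewrite -powR_mulrn ?(ltW L0)// powRAC powR_mulrn ?powR_ge0//.
  by rewrite lerXn2r ?nnegrE ?powR_ge0// ltW.
have /choice[next nextP] : forall np : nat * 'rV[R]_d, exists a, a \in S /\
    ((hit_sum U g (piece L rho [set` S] np.1 np.2) < (c / m%:R ^+ np.1)%:E)%E ->
    (hit_sum U g (piece L rho [set` S] np.1.+1 (L *: np.2 + embed R a))
       < (c / m%:R ^+ np.1.+1)%:E)%E).
  move=> [n p] /=.
  have [light|heavy] := pselect (hit_sum U g (piece L rho [set` S] n p) < (c /
    m%:R ^+ n)%:E)%E.
    have [a aS ac] := light_child AL g0' (gU n) light.
    by exists a.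
  by have [a aS] := ds_ex AL; exists a.
pose fix q n : 'rV[R]_d :=
  if n is n'.+1 then L *: q n' + embed R (next (n', q n')) else 0.
have light n : (hit_sum U g (piece L rho [set` S] n (q n)) < (c / m%:R ^+
  n)%:E)%E.
  elim: n => [|n IH].
    rewrite expr0 divr1; apply: le_lt_trans gc; exact: hit_sum_le.
  by have [_] := nextP (n, q n); apply.
have sub i j : piece L rho [set` S] (i + j) (q (i + j)%N) `<=` piece L rho
  [set` S] i (q i).
  elim: j => [|j IH]; first by rewrite addn0.
  apply: subset_trans IH; rewrite addnS; apply: (piece_child AL).
  by have [] := nextP ((i + j)%N, q (i + j)%N).
have /choice[x xq] := fun n => piece_nonempty n (q n) AL.
have F0q : piece L rho [set` S] 0 (q 0%N) = F.
  by apply/seteqP; split=> y; rewrite /piece/= expr0 scale1r subr0.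
(* A cluster point of the [x n] lies in every piece, because the pieces are closed and nested. *)
have [|y [Fy yx]] := compact_digit_set AL (F := x @ \oo) _.
  exists 0%N => // n _; rewrite -/F -F0q; exact: (sub 0%N n).
have yq n : piece L rho [set` S] n (q n) y.
  rewrite ((closure_id _).1 (@closed_piece _ _ _ _ _ _ n (q n) AL)) => B By;
    apply: yx => //.
  by exists n => // l /= nl; rewrite -(subnKC nl); apply: (sub n); exact: xq.
have [i _ Uiy] := FU _ Fy.
have gn n : (g i < (c / m%:R ^+ n)%:E)%E.
  by apply: le_lt_trans (light n); apply: le_hit_sum => //; exists y.
move: gn (gn 0%N) (g0 i); case: (g i) => [r| |]// gn _; rewrite lte_fin => r0.
(* As [m >= 2], the power [m ^ n] exceeds [n], so this level already contradicts the weight [r]. *)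
have := gn (Num.truncn (c / r)).+1; rewrite lte_fin ltr_pdivlMr ?exprn_gt0//.
apply/negP; rewrite -leNgt mulrC -ler_pdivrMr//.
apply: le_trans (ltW (truncnS_gt (c / r))) _.
by rewrite -natrX ler_nat ltnW// ltn_expl.
Qed.

Lemma hausdorff_dim_digit_set_ge (R : realType) (d N : nat) (L rho s : R)
    (S : {fset 'rV[nat]_d}) :
  digit_system N L rho [set` S] -> L `^ s = #|` S|%:R ->
  (s%:E <= hausdorff_dim (digit_set L rho [set` S]))%E.
Proof.
move=> AL Ls; have L1 := ds_L AL; have [S1|S1] := ltnP 1 #|` S|.
  apply: le_ereal_inf_tmp => _ [t [t0 Ht] <-]; rewrite lee_fin leNgt.
  apply/negP => ts; have := hausdorff_measure_digit_set AL S1 t0.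
  by rewrite -Ls Ht eqxx => /(_ (ler_powR (ltW L1) (ltW ts))).
(* With at most one digit, [L ^ s <= 1] and [L > 1] force [s <= 0]. *)
apply: le_trans (hausdorff_dim_ge0 _); rewrite lee_fin leNgt; apply/negP => s0.
move: L1; apply/negP; rewrite -leNgt.
have -> : L = (L `^ s) `^ s^-1.
  by rewrite -powRrM mulfV ?gt_eqF// powRr1// (le_trans ler01)// ltW// (ds_L
    AL).
rewrite Ls -[leRHS](congr1 (@^~ s^-1) (powR1 R)).
by rewrite ge0_ler_powR ?nnegrE ?invr_ge0 ?(ltW s0)// lern1.
Qed.

(** * Positive density and patches *)

Lemma density_le_r (R : realType) (k d N : nat) (A : set 'rV[nat]_d) :
  (0 < d)%N -> (1 < k)%N -> ~ lattice_patch k A ->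
  density_seq R A N <= (r_ R k d N)%:R / N%:R ^+ d.
Proof.
move=> d0 k1 nA; rewrite /density_seq ler_wpM2r ?invr_ge0 ?exprn_ge0// ler_nat.
have fin : finite_set (A `&` box d N) by apply: finite_setIr; exact: finite_box.
apply: card_le_r => //; rewrite fset_setK//.
by apply: contra_not nA; apply: lattice_patch_sub; exact: subIsetl.
Qed.

Lemma dense_contains_patch (R : realType) (k d : nat) (A : set 'rV[nat]_d) :
  (0 < d)%N -> (1 < k)%N ->
  ((r_ R k d N)%:R : R) / N%:R ^+ d @[N --> \oo] --> (0 : R) ->
  (0 < limn_esup (fun N : nat => (density_seq R A N)%:E))%E ->
  lattice_patch k A.
Proof.
move=> d0 k1 r0 A0; apply: contrapT => nA.
have h : density_seq R A N @[N --> \oo] --> (0 : R).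
  apply: (squeeze_cvgr _ (cvg_cst 0) r0); apply: nearW => N.
  by rewrite density_le_r// divr_ge0 ?exprn_ge0.
have h' : (density_seq R A N)%:E @[N --> \oo] --> (0 : \bar R).
  by apply/fine_cvgP; split; [exact: nearW|exact: h].
by move: A0; rewrite (cvg_limn_einf_sup h').2 ltxx.
Qed.

(** * Rapidly spaced blocks *)

(** With [B = block_start nx j] and [N = nx B], block [j] has length [N] and starts after
    [N + 2 * B]. The gap [N + B] below it exceeds both its length and everything before, yet when
    [B < N] the block ends by [4 * N], so it keeps a fixed proportion of the interval. *)
Fixpoint block_start (nx : nat -> nat) (j : nat) : nat :=
  if j is j.+1 then
    (2 * nx (block_start nx j) + 2 * block_start nx j)%N
  else 0%N.

Definition block_shift (nx : nat -> nat) (j : nat) : nat :=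
  (nx (block_start nx j) + 2 * block_start nx j)%N.

(** All coordinates receive the same shift, so any single coordinate of a point determines its
    block. *)
Definition blocks (d : nat) (nx : nat -> nat) (S : nat -> {fset 'rV[nat]_d}) :
    set 'rV[nat]_d :=
  [set x | exists j y, y \in S (nx (block_start nx j)) /\
     x = \row_i (block_shift nx j + y ord0 i)%N].

Lemma block_startS (nx : nat -> nat) (j : nat) :
  block_start nx j.+1 =
    (block_shift nx j + nx (block_start nx j))%N.
Proof. by rewrite /block_shift /=; lia. Qed.

Lemma block_start_homo (nx : nat -> nat) :
  {homo block_start nx : i j / (i <= j)%N}.
Proof.
apply: homo_leq; [exact: leqnn|by move=> a b c; exact: leq_trans|].
by move=> j; rewrite block_startS /block_shift; lia.
Qed.

Definition in_block (nx : nat -> nat) (j v : nat) :=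
  (block_shift nx j < v <= block_start nx j.+1)%N.

Lemma in_block_inj (nx : nat -> nat) (i j v : nat) :
  in_block nx i v -> in_block nx j v -> i = j.
Proof.
wlog : i j / (i < j)%N => [H|ij].
  by case: (ltngtP i j) => // ij vi vj; [exact: H|symmetry; exact: H].
have := @block_start_homo nx _ _ ij.
by rewrite /in_block /block_shift; lia.
Qed.

(** The gap below block [J] is longer than the block, so a step shorter than the block cannot enter
    it from an earlier one. *)
Lemma in_block_step (nx : nat -> nat) (J j u m : nat) :
  (m < nx (block_start nx J))%N ->
  in_block nx J (u + m)%N -> in_block nx j u -> j = J.
Proof.
move=> mJ uJ uj; case: (ltngtP j J) => // [jJ|Jj].
  have := @block_start_homo nx _ _ jJ; move: uJ uj.
  by rewrite /in_block /block_shift; lia.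
have := @block_start_homo nx _ _ Jj; move: uJ uj.
by rewrite /in_block /block_shift; lia.
Qed.

(* Each block starts beyond twice the end of the previous one, so no
   three-term progression meets two blocks. *)
Lemma in_block_progression (nx : nat -> nat) (k u m : nat) (j : nat -> nat) :
  (3 <= k)%N -> (0 < m)%N ->
  (forall c, (c < k)%N -> in_block nx (j c) (u + m * c)%N) ->
  forall c, (c < k)%N -> j c = j k.-1.
Proof.
move=> k3 m0 H; set J := j k.-1.
have HJ : in_block nx J (u + m * k.-1)%N by apply: H; lia.
have j2 : j k.-2 = J.
  have h1 : in_block nx (j k.-2) (u + m * k.-2)%N by apply: H; lia.
  have h2 : in_block nx (j (k - 3)%N) (u + m * (k - 3))%N by apply: H; lia.
  have e1 : (u + m * k.-1 = (u + m * k.-2) + m)%N.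
    by rewrite -addnA -mulnSr; congr (u + m * _)%N; lia.
  have e2 : (u + m * k.-2 = (u + m * (k - 3)) + m)%N.
    by rewrite -addnA -mulnSr; congr (u + m * _)%N; lia.
  case: (ltngtP (j k.-2) J) => // [jJ|Jj].
    have := @block_start_homo nx _ _ jJ.
    by move: HJ h1 h2; rewrite /in_block /block_shift; lia.
  have := @block_start_homo nx _ _ Jj.
  by move: HJ h1 h2; rewrite /in_block /block_shift; lia.
(* The last two terms lie in block [J], so the step is shorter than that block, and [in_block_step]
   pulls the earlier terms into [J] one at a time. *)
have mJ : (m < nx (block_start nx J))%N.
  have h1 : in_block nx (j k.-2) (u + m * k.-2)%N by apply: H; lia.
  have e1 : (u + m * k.-1 = (u + m * k.-2) + m)%N.
    by rewrite -addnA -mulnSr; congr (u + m * _)%N; lia.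
  by move: HJ h1; rewrite j2 /in_block block_startS; lia.
suff down e : (e < k)%N -> j (k.-1 - e)%N = J.
  move=> c ck; have -> : c = (k.-1 - (k.-1 - c))%N by lia.
  by apply: down; lia.
elim: e => [|e IH] ek; first by rewrite subn0.
apply: (@in_block_step nx J _ (u + m * (k.-1 - e.+1))%N m mJ);
  last by apply: H; lia.
rewrite -IH; last by lia.
have -> : (u + m * (k.-1 - e.+1) + m = u + m * (k.-1 - e))%N.
  by rewrite -addnA -mulnSr; congr (u + m * _)%N; lia.
by apply: H; lia.
Qed.

(** The points with constant index project to a progression in one coordinate, which stays in a
    single block [J]. The other points project between its ends, so the whole patch lies in block
    [J] and shifts back into one of the sets [S n]. *)
Lemma blocks_no_patch (k d : nat) (nx : nat -> nat)
    (S : nat -> {fset 'rV[nat]_d}) :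
  (0 < d)%N -> (3 <= k)%N -> (forall n, [set` S n] `<=` box d n) ->
  (forall n, ~ lattice_patch k [set` S n]) -> ~ lattice_patch k (blocks nx S).
Proof.
move=> d0 k3 Sbox nS [t [m [m0 tA]]].
have /choice[j jP] : forall x : {ffun 'I_d -> 'I_k}, exists j, exists2 y,
    y \in S (nx (block_start nx j)) &
    forall i, (t ord0 i + m * x i = block_shift nx j + y ord0 i)%N.
  move=> x; have [j [y [yS /rowP xy]]] := tA x; exists j, y => // i.
  by have := xy i; rewrite !mxE.
have inb x i : in_block nx (j x) (t ord0 i + m * x i)%N.
  have [y yS ->] := jP x; have := Sbox _ _ yS i; move: (y ord0 i) => v.
  by rewrite /in_block block_startS; lia.
pose dg c : {ffun 'I_d -> 'I_k} := [ffun=> insubd (Ordinal (ltnW (ltnW k3))) c].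
have dgE c i : (c < k)%N -> dg c i = c :> nat.
  by move=> ck; rewrite ffunE val_insubd ck.
pose J := j (dg k.-1).
have jJ : j (dg 0%N) = J.
  apply: (@in_block_progression nx k (t ord0 (Ordinal d0)) m (j \o dg) k3 m0).
    by move=> c ck; have := inb (dg c) (Ordinal d0); rewrite dgE.
  by lia.
have allJ x : j x = J.
  have h := inb x (Ordinal d0); apply: (in_block_inj h).
  have h1 := inb (dg k.-1) (Ordinal d0); have h0 := inb (dg 0%N) (Ordinal d0).
  rewrite -/J dgE in h1; last by lia.
  rewrite jJ dgE in h0; last by lia.
  have xk : (m * x (Ordinal d0) <= m * k.-1)%N.
    by rewrite leq_mul2l; have := ltn_ord (x (Ordinal d0)); lia.
  by move: h0 h1; rewrite /in_block; lia.
apply: (nS (nx (block_start nx J))).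
(* The corner of the patch lies in block [J] in every coordinate, so these subtractions are not
   truncated. *)
exists (\row_i (t ord0 i - block_shift nx J)%N), m; split=> // x /=.
have [y yS yx] := jP x; rewrite allJ in yS yx.
rewrite (_ : \row_i _ = y)//; apply/rowP => i; rewrite !mxE.
have := inb (dg 0%N) i; rewrite jJ dgE ?muln0 ?addn0; last by lia.
rewrite /in_block => /andP[ti _].
by rewrite addnBAC ?yx ?addKn// ltnW.
Qed.

Lemma limn_esup_ge (R : realType) (u : nat -> R) (c : R) :
  (forall n, exists2 m, (n <= m)%N & c <= u m) ->
  (c%:E <= limn_esup (fun n => (u n)%:E))%E.
Proof.
move=> uc; apply: le_ereal_inf_tmp => _ [V [n _ nV] <-].
have [m nm cu] := uc n; apply: le_ereal_sup_tmp; exists (u m)%:E.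
  by exists m => //; apply: nV.
by rewrite lee_fin.
Qed.

Lemma density_blocks (R : realType) (d j : nat) (nx : nat -> nat)
    (S : nat -> {fset 'rV[nat]_d}) (delta : R) :
  (forall n, [set` S n] `<=` box d n) -> (forall n, (n < nx n)%N) ->
  0 <= delta ->
  (forall n, delta * (nx n)%:R ^+ d <= #|` S (nx n)|%:R) ->
  delta / 4 ^+ d <= density_seq R (blocks nx S) (block_start nx j.+1).
Proof.
move=> Sbox nxn delta0 Sd; rewrite /density_seq.
set N := nx (block_start nx j); set B := block_start nx j.+1.
have N0 : (0 < N)%N by apply: leq_ltn_trans (nxn _).
have BN : (B <= 4 * N)%N.
  by have := nxn (block_start nx j); rewrite /B /= -/N; lia.
have B0 : (0 < B)%N by rewrite /B /= -/N; lia.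
have card : (#|` S N| <= #|` fset_set (blocks nx S `&` box d B)|)%N.
  pose f (y : 'rV[nat]_d) : 'rV[nat]_d :=
    \row_i (block_shift nx j + y ord0 i)%N.
  have fI : injective f.
    by move=> y z /rowP yz; apply/rowP => i; have := yz i;
      rewrite !mxE => /addnI.
  rewrite (_ : #|` S N| = #|` [fset f y | y in S N]%fset|)%N;
    last by rewrite card_imfset.
  apply: fsubset_leq_card; apply/fsubsetP => x.
  move=> /imfsetP[y /= yS ->]; rewrite in_fset_set; last first.
    by apply: finite_setIr; exact: finite_box.
  rewrite inE; split; first by exists j, y.
  move=> i; rewrite mxE; have /andP[y1 y2] := Sbox _ _ yS i.
  by rewrite /B block_startS; rewrite -/N; lia.
rewrite ler_pdivlMr ?exprn_gt0 ?ltr0n//.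
apply: le_trans (_ : #|` S N|%:R <= _); last by rewrite ler_nat.
apply: le_trans (Sd (block_start nx j)); rewrite -/N.
rewrite mulrAC ler_pdivrMr ?exprn_gt0// -mulrA ler_wpM2l//.
rewrite -exprMn lerXn2r ?nnegrE ?mulr_ge0//.
by rewrite -[X in _ * X]/(4%:R) -natrM ler_nat mulnC.
Qed.

Lemma r_cvg0_of_dense (R : realType) (k d : nat) : (0 < d)%N -> (3 <= k)%N ->
  (forall A : set 'rV[nat]_d, A `<=` pos_lattice d ->
    (0 < limn_esup (fun N : nat => (density_seq R A N)%:E))%E ->
    lattice_patch k A) ->
  ((r_ R k d N)%:R : R) / N%:R ^+ d @[N --> \oo] --> (0 : R).
Proof.
move=> d0 k3 dense; have k1 : (1 < k)%N by apply: ltnW.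
apply/cvgr0Pnorm_lt => delta delta0; apply: contrapT => nlt.
(* If the ratio does not tend to 0, arbitrarily large [N] have extremal sets of density at least
   [delta]; [nx] selects them as blocks. *)
have /choice[nx nxP] : forall n, exists N, (n < N)%N /\
    delta * N%:R ^+ d <= (r_ R k d N)%:R.
  move=> n; apply: contrapT => nN; apply: nlt; exists n.+1 => // N /= nN'.
  rewrite ger0_norm ?divr_ge0 ?exprn_ge0// ltNge; apply/negP => h.
  apply: nN; exists N; split=> //.
  by rewrite -ler_pdivlMr// exprn_gt0// ltr0n; lia.
have /choice[S SP] := fun N => r_attained R N d0 k1.
have Sbox n : [set` S n] `<=` box d n by have [] := SP n.
have nS n : ~ lattice_patch k [set` S n] by have [] := SP n.
have nxn n : (n < nx n)%N by have [] := nxP n.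
apply: (blocks_no_patch (nx := nx) d0 k3 Sbox nS); apply: dense.
  move=> x [j [y [yS ->]]] i; rewrite mxE.
  by have := Sbox _ _ yS i; move: (y ord0 i) => v; lia.
apply: (@lt_le_trans _ _ (delta / 4 ^+ d)%:E).
  by rewrite lte_fin divr_gt0// exprn_gt0.
apply: limn_esup_ge => n; exists (block_start nx n.+1).
  elim: n => [//|n IH]; rewrite block_startS /block_shift.
  by have := nxn (block_start nx n.+1); lia.
apply: density_blocks => // [|m]; first exact: ltW.
by have [_ _ ->] := SP (nx m); have [] := nxP m.
Qed.

(** * Comparison of the exponents *)

Lemma powR_ln_ratio (R : realType) (b q : R) :
  1 < b -> 0 < q -> b `^ (ln q / ln b) = q.
Proof.
move=> b1 q0; have b0 : 0 < b by apply: lt_trans b1.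
by rewrite /powR gt_eqF// divfK ?gt_eqF ?ln_gt0// lnK.
Qed.

(* [fine] sends the supremum [-oo] of an empty family to the junk value 0. *)
Lemma fine_ereal_sup_le (R : realType) (E1 E2 : set (\bar R)) (s : R) :
  (forall x, E1 x -> (0 <= x)%E) -> (forall x, E2 x -> (0 <= x)%E) ->
  (ereal_sup E1 <= ereal_sup E2)%E -> (ereal_sup E2 <= s%:E)%E ->
  fine (ereal_sup E1) <= fine (ereal_sup E2).
Proof.
have sup_ge0 (E : set (\bar R)) : (forall x, E x -> (0 <= x)%E) ->
    E = set0 \/ (0 <= ereal_sup E)%E.
  move=> E0; have [->|/set0P[x Ex]] := eqVneq E set0; [by left|right].
  by apply: le_ereal_sup_tmp; exists x => //; exact: E0.
move=> E10 E20 E12 E2s.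
have [->|E1n] := sup_ge0 _ E10; rewrite ?ereal_sup0/=.
  by have [->|E2n] := sup_ge0 _ E20; rewrite ?ereal_sup0//= fine_ge0.
have E2n := le_trans E1n E12.
have lty : (ereal_sup E2 < +oo)%E by apply: le_lt_trans (ltry s).
by rewrite fine_le// ge0_fin_numE// (le_lt_trans E12).
Qed.

Lemma D_A_le (R : realType) (k d N M : nat) (eps sigma : R) :
  (0 < d)%N -> (1 < k)%N -> (1 < M)%N -> (0 < N)%N -> d%:R <= eps * M%:R ->
  0 <= sigma -> (M * N)%N%:R `^ sigma = (M ^ d * r_ R k d N)%N%:R ->
  (D_A k eps d <= sigma%:E)%E.
Proof.
move=> d0 k1 M1 N0 dM s0 sE; apply: ge_ereal_sup => _ [F [v vo nF] <-].
exact: assouad_dim_le dM nF s0 sE.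
Qed.

Lemma D_A_le_dim (R : realType) (k d : nat) (eps : R) :
  (0 < d)%N -> (1 < k)%N -> 0 < eps -> (D_A k eps d <= d%:R%:E)%E.
Proof.
(* For [N = 1] the refinement bound merely counts all [M ^ d] cells, which gives the exponent
   [d]. *)
move=> d0 k1 e0; pose M := (Num.truncn (d%:R / eps)).+2.
apply: (@D_A_le R k d 1 M) => //.
  rewrite mulrC -ler_pdivrMr//; apply: le_trans (ltW (truncnS_gt _)) _.
  by rewrite ler_nat.
have -> : r_ R k d 1 = 1%N.
  apply/eqP; rewrite eqn_leq r_gt0// andbT.
  by have := r_le R 1 d0 k1; rewrite exp1n.
by rewrite !muln1 powR_mulrn// natrX.
Qed.

Lemma D_H_le_D_A (R : realType) (k d : nat) (eps : R) :
  (D_H k eps d <= D_A k eps d)%E.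
Proof.
apply: ge_ereal_sup => _ [F [Fc vF] <-].
apply: le_trans (compact_hausdorff_dim_le_assouad Fc) _.
by apply: ereal_sup_ubound; exists F.
Qed.

Lemma D_S_le_D_H (R : realType) (k d : nat) (eps : R) :
  (D_S k eps d <= D_H k eps d)%E.
Proof.
apply: ge_ereal_sup => _ [F [[n [f [_ _ [_ Fc _]]]] nF] <-].
apply: ereal_sup_ubound; exists F => //; split=> //.
by exists (@std_basis R d) => //; exact: orthonormal_std_basis.
Qed.

Lemma fine_D_H_le_D_A (R : realType) (k d : nat) (eps : R) :
  (0 < d)%N -> (1 < k)%N -> 0 < eps ->
  fine (D_H k eps d) <= fine (D_A k eps d).
Proof.
move=> d0 k1 e0; apply: (fine_ereal_sup_le (s := d%:R)).
- by move=> _ [F _ <-]; exact: hausdorff_dim_ge0.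
- by move=> _ [F _ <-]; exact: assouad_dim_ge0.
- exact: D_H_le_D_A.
- exact: D_A_le_dim.
Qed.

Lemma fine_D_S_le_D_H (R : realType) (k d : nat) (eps : R) :
  (0 < d)%N -> (1 < k)%N -> 0 < eps ->
  fine (D_S k eps d) <= fine (D_H k eps d).
Proof.
move=> d0 k1 e0; apply: (fine_ereal_sup_le (s := d%:R)).
- by move=> _ [F _ <-]; exact: hausdorff_dim_ge0.
- by move=> _ [F _ <-]; exact: hausdorff_dim_ge0.
- exact: D_S_le_D_H.
- by apply: le_trans (D_A_le_dim d0 k1 e0); exact: D_H_le_D_A.
Qed.

(** For [eps <= 1] the power decreases in its exponent, so a smaller dimension gives a smaller
    value. *)
Lemma cvg_eps_pow_codim_le (R : realType) (d : nat) (D D' : R -> \bar R) :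
  (forall eps, 0 < eps -> fine (D eps) <= fine (D' eps)) ->
  eps_pow_codim eps d (D' eps) @[eps --> (0 : R)^'+] --> (0 : R) ->
  eps_pow_codim eps d (D eps) @[eps --> (0 : R)^'+] --> (0 : R).
Proof.
move=> DD' D'0; apply: (squeeze_cvgr _ (cvg_cst 0) D'0).
near=> eps; have e0 : 0 < eps by near: eps; exact: nbhs_right_gt.
rewrite powR_ge0/=; apply: ger_powR.
  by rewrite e0/= ltW//; near: eps; exact: nbhs_right_lt.
by rewrite lerB// DD'.
Unshelve. all: by end_near. Qed.

(** With [M] just above [d / eps] and [eps] small in terms of [N], the base [b = M * N] is at most
    [eps ^ (-2)]. Hence the square of [eps ^ (d - sigma)] is at most [b ^ (sigma - d) = q / b ^ d],
    which equals [r(N) / N ^ d]. *)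
Lemma D_A_codim_lt (R : realType) (k d N : nat) (eps theta : R) :
  (0 < d)%N -> (1 < k)%N -> (0 < N)%N -> 0 < eps < 1 ->
  eps * (N%:R * (d%:R + 1)) < 1 -> 0 < theta ->
  (r_ R k d N)%:R / N%:R ^+ d < theta ^+ 2 ->
  eps_pow_codim eps d (D_A k eps d) < theta.
Proof.
move=> d0 k1 N0 /andP[e0 e1] eN theta0 rN.
have d1 : 1 <= d%:R :> R by rewrite ler1n.
have N1 : 1 <= N%:R :> R by rewrite ler1n.
pose M := (Num.truncn (d%:R / eps)).+1.
have dM : d%:R / eps <= M%:R by apply: ltW; exact: truncnS_gt.
have Md : M%:R <= d%:R / eps + 1.
  by rewrite -natr1 lerD2r truncn_le// divr_ge0// ltW.
have dM' : d%:R <= eps * M%:R by rewrite mulrC -ler_pdivrMr.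
have M1 : (1 < M)%N.
  rewrite -(ltr_nat R); apply: lt_le_trans dM; rewrite ltr_pdivlMr// mul1r.
  exact: lt_le_trans e1 d1.
have b1 : (1 < M * N)%N by rewrite (leq_trans M1)// leq_pmulr.
set q := (M ^ d * r_ R k d N)%N; pose b : R := (M * N)%N%:R.
have b1' : 1 < b by rewrite ltr1n.
have b0 : 0 < b by apply: lt_trans b1'.
have q1 : (1 <= q)%N by rewrite muln_gt0 expn_gt0 (ltnW M1) r_gt0.
have q0 : 0 < q%:R :> R by rewrite ltr0n.
have lnb : 0 < ln b by rewrite ln_gt0.
pose sigma : R := ln q%:R / ln b.
have sigma0 : 0 <= sigma by apply: divr_ge0;
  [rewrite ln_ge0// ler1n|exact: ltW].
have sigmaE : b `^ sigma = q%:R by rewrite powR_ln_ratio.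
have sigmad : sigma <= d%:R.
  rewrite ler_pdivrMr// mulr_natl -lnXn// ler_ln ?posrE ?exprn_gt0//.
  by rewrite /b -natrX ler_nat expnMn leq_mul2l r_le// orbT.
have Ds : fine (D_A k eps d) <= sigma.
  have := D_A_le d0 k1 M1 N0 dM' sigma0 sigmaE.
  by case: (D_A k eps d) => [x| |]//=; rewrite lee_fin.
have eb : eps ^+ 2 <= b^-1.
  rewrite -[leRHS]mul1r ler_pdivlMr// expr2 -mulrA.
  apply: le_trans (ltW eN); rewrite ler_pM2l// /b natrM mulrA mulrC.
  rewrite ler_pM2l; last exact: lt_le_trans N1.
  have : eps * M%:R <= eps * (d%:R / eps + 1) by rewrite ler_pM2l.
  rewrite mulrDr mulrCA divff ?gt_eqF//; lra.
apply: le_lt_trans (_ : eps `^ (d%:R - sigma) < theta).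
  by apply: ger_powR; [rewrite e0 ltW|rewrite lerB].
rewrite -(@ltr_pXn2r _ 2) ?nnegrE ?powR_ge0 ?(ltW theta0)//.
apply: le_lt_trans rN.
rewrite -powR_mulrn ?powR_ge0// powRAC powR_mulrn ?(ltW e0)//.
apply: (@le_trans _ _ (b^-1 `^ (d%:R - sigma))).
  by rewrite ge0_ler_powR ?nnegrE ?subr_ge0 ?exprn_ge0 ?invr_ge0// ltW.
rewrite -powR_inv1 ?(ltW b0)// -powRrM mulN1r opprB powRB; last first.
  by rewrite implybE (gt_eqF b0) orbT.
rewrite sigmaE powR_mulrn ?(ltW b0)// /q /b !natrM exprMn natrX.
have Md0 : M%:R ^+ d != 0 :> R by rewrite expf_neq0// pnatr_eq0 -lt0n ltnW.
by rewrite -mulf_div divff// mul1r.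
Qed.

Lemma D_A_codim_cvg (R : realType) (k d : nat) : (0 < d)%N -> (1 < k)%N ->
  ((r_ R k d N)%:R : R) / N%:R ^+ d @[N --> \oo] --> (0 : R) ->
  eps_pow_codim eps d (D_A k eps d) @[eps --> (0 : R)^'+] --> (0 : R).
Proof.
move=> d0 k1 /cvgr0Pnorm_lt r0; apply/cvgr0Pnorm_lt => theta theta0.
have [n _ /(_ n.+1 (leqnSn n))/=] := r0 (theta ^+ 2) (exprn_gt0 2 theta0).
rewrite ger0_norm ?divr_ge0 ?exprn_ge0// => rN.
have K0 : 0 < (n.+1%:R * (d%:R + 1) : R) by rewrite mulr_gt0// ltr_wpDl.
near=> eps; have e0 : 0 < eps by near: eps; exact: nbhs_right_gt.
rewrite ger0_norm ?powR_ge0//; apply: (@D_A_codim_lt R k d n.+1) => //.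
  by rewrite e0/=; near: eps; exact: nbhs_right_lt.
rewrite -ltr_pdivlMr// mul1r; near: eps; apply: nbhs_right_lt.
Unshelve. all: by end_near. Qed.

(** Since [L >= 8], the tolerance [1 / (8 L)] is at least [L ^ (-2)]; with [L ^ s = r(N)] this
    bounds the power below by [L ^ (2 (s - d))]. *)
Lemma D_S_codim_ge (R : realType) (k d N : nat) (L : R) :
  (0 < d)%N -> (1 < k)%N -> (0 < N)%N -> L = 8 * k.+1%:R * N%:R + 1 ->
  ((r_ R k d N)%:R / L ^+ d) ^+ 2
    <= eps_pow_codim (8 * L)^-1 d (D_S k (8 * L)^-1 d).
Proof.
move=> d0 k1 N0 LE; set eps := (8 * L)^-1.
have N1 : 1 <= N%:R :> R by rewrite ler1n.
have k1' : 2 <= k.+1%:R :> R by rewrite ler_nat ltnW.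
have kN : 2 <= k.+1%:R * N%:R :> R
  by rewrite -natrM ler_nat (@leq_trans k.+1) ?leq_pmulr// ltnW.
have L8 : 8 <= L by rewrite LE -mulrA; lra.
have L0 : 0 < L by apply: lt_le_trans L8.
have L1 : 1 < L by apply: lt_le_trans L8; rewrite ltr1n.
have e0 : 0 < eps by rewrite invr_gt0 mulr_gt0.
have NL : N%:R <= L.
  have : 0 <= (8 * k.+1%:R - 1) * N%:R :> R by rewrite mulr_ge0//; lra.
  by rewrite LE; lra.
(* The largest [rho] allowed by [digit_set_no_AP]; the value of [L] then gives [N + rho = L * rho]
   exactly. *)
pose rho : R := (8 * k.+1%:R)^-1.
have rhok : 8 * k.+1%:R * rho = 1 by rewrite /rho divff// mulf_neq0.
have rho0 : 0 < rho by rewrite invr_gt0 mulr_gt0.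
have [S [SN nS cS]] := r_attained R N d0 k1.
have r0 : (0 < r_ R k d N)%N by exact: r_gt0.
have AL : digit_system N L rho [set` S].
  split=> //.
  - by rewrite /rho invf_lt1 ?mulr_gt0//; lra.
  - by rewrite LE mulrDl mul1r mulrAC rhok mul1r.
  - by move: r0; rewrite -cS cardfs_gt0 => /fset0Pn[a aS]; exists a.
pose s : R := ln (r_ R k d N)%:R / ln L.
have lnL : 0 < ln L by rewrite ln_gt0.
have r0' : 0 < (r_ R k d N)%:R :> R by rewrite ltr0n.
have sE : L `^ s = (r_ R k d N)%:R by rewrite powR_ln_ratio.
have sd : s <= d%:R.
  rewrite ler_pdivrMr// mulr_natl -lnXn// ler_ln ?posrE ?exprn_gt0//.
  apply: (@le_trans _ _ (N%:R ^+ d)); first by rewrite -natrX ler_nat r_le.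
  by rewrite lerXn2r ?nnegrE// ltW.
have sD : s <= fine (D_S k eps d).
  have : (s%:E <= D_S k eps d)%E.
    apply: le_ereal_sup_tmp; exists (hausdorff_dim (digit_set L rho [set` S])).
      exists (digit_set L rho [set` S]) => //; split.
        exact: digit_set_self_similar AL.
      by apply: digit_set_no_AP AL _ _ nS => //; [rewrite rhok|lra].
    by apply: hausdorff_dim_digit_set_ge AL _; rewrite cS.
  have : (D_S k eps d <= d%:R%:E)%E.
    apply: le_trans (D_S_le_D_H _ _ _) _.
    by apply: le_trans (D_H_le_D_A _ _ _) _; exact: D_A_le_dim.
  by case: (D_S k eps d) => [x| |]//=; rewrite lee_fin.
have eL : (L ^+ 2)^-1 <= eps.
  by rewrite lef_pV2 ?posrE ?exprn_gt0 ?mulr_gt0// expr2 ler_pM2r.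
have e1 : eps <= 1 by rewrite invf_le1 ?mulr_gt0//; lra.
apply: (@le_trans _ _ (eps `^ (d%:R - s))); last first.
  by apply: ger_powR; [rewrite e0|rewrite lerB].
apply: (@le_trans _ _ ((L ^+ 2)^-1 `^ (d%:R - s))); last first.
  by rewrite ge0_ler_powR ?nnegrE ?(ltW e0) ?subr_ge0 ?invr_ge0 ?exprn_ge0
    ?(ltW L0).
rewrite -(powR_inv1 (exprn_ge0 2 (ltW L0))) -powRrM mulN1r opprB.
rewrite -(powR_mulrn 2 (ltW L0)) powRAC powR_mulrn ?powR_ge0//.
rewrite powRB; last by rewrite implybE (gt_eqF L0) orbT.
by rewrite sE powR_mulrn// ltW.
Qed.

Lemma r_cvg0_of_D_S (R : realType) (k d : nat) : (0 < d)%N -> (1 < k)%N ->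
  eps_pow_codim eps d (D_S k eps d) @[eps --> (0 : R)^'+] --> (0 : R) ->
  ((r_ R k d N)%:R : R) / N%:R ^+ d @[N --> \oo] --> (0 : R).
Proof.
move=> d0 k1 /cvgr0Pnorm_lt D0; apply/cvgr0Pnorm_lt => eta eta0.
(* [L <= (8 (k + 1) + 1) N], so [C] is the cost of replacing [L ^ d] by [N ^ d]; the square in
   [D_S_codim_ge] calls for the tolerance [theta ^+ 2] below. *)
pose C : R := (8 * k.+1%:R + 1) ^+ d.
have C0 : 0 < C by rewrite exprn_gt0// ltr_wpDl// mulr_ge0.
pose theta := eta / C; have theta0 : 0 < theta by rewrite divr_gt0.
have [delta /= delta0 deltaP] := D0 (theta ^+ 2) (exprn_gt0 2 theta0).
exists (Num.truncn delta^-1).+1 => // N /= dN.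
have N0 : (0 < N)%N by apply: leq_trans dN.
have N1 : 1 <= N%:R :> R by rewrite ler1n.
have k1' : 2 <= k.+1%:R :> R by rewrite ler_nat ltnW.
have Nd : delta^-1 < N%:R by apply: lt_le_trans (truncnS_gt _) _;
  rewrite ler_nat.
pose L : R := 8 * k.+1%:R * N%:R + 1.
have rL := D_S_codim_ge d0 k1 N0 (erefl L).
have NL : N%:R <= L.
  have : 0 <= (8 * k.+1%:R - 1) * N%:R :> R by rewrite mulr_ge0//; lra.
  by rewrite /L; lra.
have L0 : 0 < L by apply: lt_le_trans NL; rewrite ltr0n.
have LC : L ^+ d <= C * N%:R ^+ d.
  rewrite /C -exprMn lerXn2r ?nnegrE ?(ltW L0)//.
  by rewrite mulrDl mul1r lerD2l.
have e0 : 0 < (8 * L)^-1 by rewrite invr_gt0 mulr_gt0.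
have ed : (8 * L)^-1 < delta.
  rewrite -[ltRHS]invrK ltf_pV2 ?posrE ?invr_gt0 ?mulr_gt0//.
  by apply: lt_le_trans Nd _; apply: le_trans NL _; lra.
have := deltaP (8 * L)^-1; rewrite /ball/= sub0r normrN ger0_norm ?(ltW e0)//.
move=> /(_ ed e0); rewrite ger0_norm ?powR_ge0// => /(le_lt_trans rL).
rewrite ltr_pXn2r ?nnegrE ?(ltW theta0) ?divr_ge0 ?exprn_ge0 ?(ltW L0)// => rt.
rewrite ger0_norm ?divr_ge0 ?exprn_ge0//.
rewrite ltr_pdivrMr ?exprn_gt0 ?ltr0n//.
move: rt; rewrite ltr_pdivrMr ?exprn_gt0// => /lt_le_trans; apply.
apply: (@le_trans _ _ (theta * (C * N%:R ^+ d))); first by rewrite ler_pM2l.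
by rewrite mulrA divfK// gt_eqF.
Qed.

Theorem corollary2p7 (R : realType) (k d : nat) (hk : (3 <= k)%N)
    (hd : (1 <= d)%N) :
  [<-> forall A : set 'rV[nat]_d, A `<=` pos_lattice d ->
         (0 < limn_esup (fun N : nat => (density_seq R A N)%:E))%E ->
         contains_AP k 0 (@std_basis R d) (@embed R d @` A);
       ((r_ R k d N)%:R : R) / N%:R ^+ d @[N --> \oo] --> (0 : R);
       eps_pow_codim eps d (D_S k eps d) @[eps --> (0 : R)^'+] --> (0 : R);
       eps_pow_codim eps d (D_H k eps d) @[eps --> (0 : R)^'+] --> (0 : R);
       eps_pow_codim eps d (D_A k eps d) @[eps --> (0 : R)^'+] --> (0 : R)].
Proof.
have k1 : (1 < k)%N := ltnW hk.
have ii_v := @D_A_codim_cvg R k d hd k1.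
have v_iv :
    eps_pow_codim eps d (D_A k eps d) @[eps --> (0 : R)^'+] --> (0 : R) ->
    eps_pow_codim eps d (D_H k eps d) @[eps --> (0 : R)^'+] --> (0 : R).
  by apply: cvg_eps_pow_codim_le => eps; exact: fine_D_H_le_D_A.
have iv_iii :
    eps_pow_codim eps d (D_H k eps d) @[eps --> (0 : R)^'+] --> (0 : R) ->
    eps_pow_codim eps d (D_S k eps d) @[eps --> (0 : R)^'+] --> (0 : R).
  by apply: cvg_eps_pow_codim_le => eps; exact: fine_D_S_le_D_H.
have iii_ii := @r_cvg0_of_D_S R k d hd k1.
(* The equivalence asks for a cycle in the listed order, so each link is composed from the
   implications above. *)
split.
  move=> dense; apply: r_cvg0_of_dense => // A Apos A0.
  by apply: (embed_AP0_lattice_patch (R := R)) => //; exact: dense.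
split; first by move=> /ii_v /v_iv /iv_iii.
split; first by move=> /iii_ii /ii_v /v_iv.
split; first by move=> /iv_iii /iii_ii /ii_v.
move=> /v_iv /iv_iii /iii_ii r0 A _ A0.
by apply: contains_patch_AP0; apply: lattice_patch_embed;
  exact: dense_contains_patch r0 A0.
Qed.
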